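(* For every $a>0$, the catenoid $\mathcal{C}_a$ in $\mathbb{H}^2\times\mathbb{R}$ parametrized by $X(a,s,\theta)$, $s\in\mathbb{R}$, $\theta\in[0,2\pi]$, does not satisfy Lindelöf's property: the domains $\mathcal{D}_{\pm}=X(a,\mathbb{R}_{\pm},[0,2\pi])$ are not maximally weakly stable. More precisely, there exists a unique $\ell(a)\in\,]0,z(a)[$ such that $\mathcal{D}'_{\ell(a)}:=X(a,]-\ell(a),\infty[,[0,2\pi])$ is maximally weakly stable among rotationally invariant domains. Here $z(a)$ is the unique positive zero of the function $s\mapsto e(a,s)$.
   Context: $\mathbb{H}^2$ is the hyperbolic plane of curvature $-1$ in the ball (disk) model, and $\mathbb{H}^2\times\mathbb{R}$ carries the product metric. For $a>0$, $s\in\mathbb{R}$, $R(a,s)\ge a$ is defined by $\cosh R(a,s)=\cosh a\cosh s$, and $$\Lambda(a,s)=\sinh(a)\int_0^s(\cosh^2(a)\cosh^2(t)-1)^{-1/2}\,dt.$$ With $\omega_\theta=(\cos\theta,\sin\theta)$, the catenoid $\mathcal{C}_a$ (a minimal surface of revolution about the axis $\{0\}\times\mathbb{R}$) is parametrized by $X(a,s,\theta)=(\tanh(R(a,s)/2)\,\omega_\theta,\ \Lambda(a,s))$; its induced metric is $ds^2+\sinh^2(R(a,s))\,d\theta^2$. The variation Jacobi field is $e(a,s)=\Lambda_sR_a-\Lambda_aR_s$ (subscripts are partial derivatives), i.e. $$e(a,s)=\frac{\sinh^2(a)\cosh(s)}{\cosh^2(a)\cosh^2(s)-1}-v(a,s)\int_0^s\frac{\cosh(a)\sinh^2(t)}{(\cosh^2(a)\cosh^2(t)-1)^{3/2}}\,dt,$$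 with $v(a,s)=R_s=\cosh(a)\sinh(s)(\cosh^2(a)\cosh^2(s)-1)^{-1/2}$. It is an even function of $s$ having a unique positive zero $z(a)$. Stability: for a minimal orientable hypersurface $M$ of a Riemannian manifold with unit normal $N$ and second fundamental form $A$, the Jacobi operator is $J_M=-\Delta-(\mathrm{Ric}(N,N)+|A|^2)$, with $\Delta$ the non-positive Laplacian of the induced metric and $\mathrm{Ric}$ the ambient Ricci curvature. A domain $D\subset M$ is weakly stable if $\int_M fJ_M(f)\,d\mu_M\ge0$ for all smooth $f$ with compact support in (the interior of) $D$. A domain is maximally weakly stable (resp. maximally weakly stable among rotationally invariant domains) if it is weakly stable and no strictly larger open domain (resp. no strictly larger rotationally invariant open domain) is weakly stable; for $\mathcal D_\pm$ this refers to the open halves $\{\pm s>0\}$. Lindelöf's property for $\mathcal{C}_a$: the upper half of $\mathcal{C}_a$ is a maximal weakly stable domain among domains invariant under rotations about the axis. *)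

(* Defs.v *)
From Stdlib Require Import Reals List Lra.
From Coquelicot Require Import Coquelicot.
Open Scope R_scope.

(** * The ambient space: the unit disk times the line *)

Definition point : Type := (R * R * R)%type.

Inductive axis : Set := ax | ay | at_.

Definition sum_axis (F : axis -> R) : R := F ax + F ay + F at_.

Definition coord (i : axis) (p : point) : R :=
  let '(x, y, t) := p in
  match i with ax => x | ay => y | at_ => t end.

Definition pderiv (i : axis) (F : point -> R) (p : point) : R :=
  let '(x, y, t) := p in
  match i with
  | ax => Derive (fun u => F (u, y, t)) x
  | ay => Derive (fun u => F (x, u, t)) y
  | at_ => Derive (fun u => F (x, y, u)) t
  end.

(** The product metric: curvature -1 Poincare metric on the disk, plus dt^2.
    It is meaningful only where x^2 + y^2 < 1. *)
Definition gmet (i j : axis) (p : point) : R :=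
  let '(x, y, t) := p in
  match i, j with
  | ax, ax | ay, ay => (2 / (1 - x ^ 2 - y ^ 2)) ^ 2
  | at_, at_ => 1
  | _, _ => 0
  end.

Definition gmet_inv (i j : axis) (p : point) : R :=
  let '(x, y, t) := p in
  match i, j with
  | ax, ax | ay, ay => ((1 - x ^ 2 - y ^ 2) / 2) ^ 2
  | at_, at_ => 1
  | _, _ => 0
  end.

Lemma gmet_invP (x y t : R) (i j : axis) :
  x ^ 2 + y ^ 2 < 1 ->
  sum_axis (fun k => gmet i k (x, y, t) * gmet_inv k j (x, y, t)) =
  match i, j with
  | ax, ax | ay, ay | at_, at_ => 1
  | _, _ => 0
  end.
Proof.
intros H; destruct i, j; unfold sum_axis, gmet, gmet_inv; field; lra.
Qed.

(** [christoffel k i j] is Gamma^k_ij. *)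
Definition christoffel (k i j : axis) (p : point) : R :=
  / 2 * sum_axis (fun l =>
    gmet_inv k l p *
    (pderiv i (gmet j l) p + pderiv j (gmet i l) p - pderiv l (gmet i j) p)).

(** Sign convention: the Ricci tensor of the hyperbolic plane is minus its
    metric. *)
Definition ricci (i j : axis) (p : point) : R :=
  sum_axis (fun k =>
    pderiv k (christoffel k i j) p - pderiv j (christoffel k i k) p +
    sum_axis (fun l =>
      christoffel k k l p * christoffel l i j p -
      christoffel k j l p * christoffel l i k p)).

(** * Geometry of a parametrized surface [Y] in the ambient space *)

Inductive param : Set := ps | pth.

Definition sum_param (F : param -> R) : R := F ps + F pth.

Definition dparam (b : param) (F : R -> R -> R) (s th : R) : R :=
  match b with
  | ps => Derive (fun u => F u th) s
  | pth => Derive (fun u => F s u) th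
  end.

Definition surface : Type := R -> R -> point.

(** i-th coordinate of the tangent vector d_b Y *)
Definition tangent (Y : surface) (b : param) (i : axis) (s th : R) : R :=
  dparam b (fun u v => coord i (Y u v)) s th.

Definition hmet (Y : surface) (b c : param) (s th : R) : R :=
  sum_axis (fun i => sum_axis (fun j =>
    gmet i j (Y s th) * tangent Y b i s th * tangent Y c j s th)).

Definition hdet (Y : surface) (s th : R) : R :=
  hmet Y ps ps s th * hmet Y pth pth s th -
  hmet Y ps pth s th * hmet Y pth ps s th.

Definition hmet_inv (Y : surface) (b c : param) (s th : R) : R :=
  match b, c with
  | ps, ps => hmet Y pth pth s th
  | pth, pth => hmet Y ps ps s th
  | ps, pth => - hmet Y ps pth s th
  | pth, ps => - hmet Y pth ps s th
  end / hdet Y s th.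

(** The Euclidean cross product of the two tangent vectors, read as a covector,
    annihilates both of them; raising its index with the metric and normalizing
    gives a unit normal. *)
Definition conormal (Y : surface) (i : axis) (s th : R) : R :=
  let T b j := tangent Y b j s th in
  match i with
  | ax => T ps ay * T pth at_ - T ps at_ * T pth ay
  | ay => T ps at_ * T pth ax - T ps ax * T pth at_
  | at_ => T ps ax * T pth ay - T ps ay * T pth ax
  end.

Definition unit_normal (Y : surface) (i : axis) (s th : R) : R :=
  sum_axis (fun j => gmet_inv i j (Y s th) * conormal Y j s th) /
  sqrt (sum_axis (fun j => sum_axis (fun k =>
    gmet_inv j k (Y s th) * conormal Y j s th * conormal Y k s th))).

(** k-th coordinate of the ambient covariant derivative of d_c Y along d_b Y *)
Definition cov_tangent (Y : surface) (b c : param) (k : axis) (s th : R) : R :=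
  dparam b (tangent Y c k) s th +
  sum_axis (fun i => sum_axis (fun j =>
    christoffel k i j (Y s th) * tangent Y b i s th * tangent Y c j s th)).

Definition second_form (Y : surface) (b c : param) (s th : R) : R :=
  sum_axis (fun i => sum_axis (fun j =>
    gmet i j (Y s th) * cov_tangent Y b c i s th * unit_normal Y j s th)).

Definition second_form_norm2 (Y : surface) (s th : R) : R :=
  sum_param (fun b => sum_param (fun c =>
  sum_param (fun b' => sum_param (fun c' =>
    hmet_inv Y b b' s th * hmet_inv Y c c' s th *
    second_form Y b c s th * second_form Y b' c' s th)))).

Definition ricci_normal (Y : surface) (s th : R) : R :=
  sum_axis (fun i => sum_axis (fun j =>
    ricci i j (Y s th) * unit_normal Y i s th * unit_normal Y j s th)).

(** Laplace-Beltrami operator of the induced metric (the non-positive one), on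
    functions of the parameters. *)
Definition laplacian (Y : surface) (u : R -> R -> R) (s th : R) : R :=
  / sqrt (hdet Y s th) *
  sum_param (fun b =>
    dparam b (fun s' th' =>
      sqrt (hdet Y s' th') *
      sum_param (fun c => hmet_inv Y b c s' th' * dparam c u s' th')) s th).

Definition jacobi_op (Y : surface) (u : R -> R -> R) (s th : R) : R :=
  - laplacian Y u s th -
  (ricci_normal Y s th + second_form_norm2 Y s th) * u s th.

(** Integral over a surface of which [Y], restricted to th in [0, 2 PI[, is a
    bijective parametrization. *)
Definition surface_integral (Y : surface) (h : R -> R -> R) : R :=
  RInt_gen
    (fun s => RInt (fun th => h s th * sqrt (hdet Y s th)) 0 (2 * PI))
    (Rbar_locally m_infty) (Rbar_locally p_infty).

(** * The catenoids *)

Definition arcosh (x : R) : R := ln (x + sqrt (x ^ 2 - 1)).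

Lemma cosh_arcosh (x : R) : 1 <= x -> cosh (arcosh x) = x.
Proof.
intros H; unfold cosh, arcosh.
assert (Hs := sqrt_pos (x ^ 2 - 1)).
assert (Hq : sqrt (x ^ 2 - 1) * sqrt (x ^ 2 - 1) = x ^ 2 - 1)
  by (apply sqrt_sqrt; nra).
rewrite exp_Ropp, exp_ln by lra.
assert (Hi : / (x + sqrt (x ^ 2 - 1)) = x - sqrt (x ^ 2 - 1)).
{ apply (Rmult_eq_reg_l (x + sqrt (x ^ 2 - 1))); [|lra].
  rewrite Rinv_r by lra; nra. }
rewrite Hi; field.
Qed.

Lemma arcosh_ge0 (x : R) : 1 <= x -> 0 <= arcosh x.
Proof.
intros H; unfold arcosh; rewrite <- ln_1.
assert (Hs := sqrt_pos (x ^ 2 - 1)).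
apply ln_le; lra.
Qed.

Definition radius (a s : R) : R := arcosh (cosh a * cosh s).

Definition Lambda (a s : R) : R :=
  sinh a * RInt (fun t => / sqrt (cosh a ^ 2 * cosh t ^ 2 - 1)) 0 s.

Definition X (a : R) : surface := fun s th =>
  (tanh (radius a s / 2) * cos th, tanh (radius a s / 2) * sin th, Lambda a s).

Definition e (a s : R) : R :=
  Derive (fun u => Lambda a u) s * Derive (fun b => radius b s) a -
  Derive (fun b => Lambda b s) a * Derive (fun u => radius a u) s.

(** [X a] applied to I x [0, 2 PI] *)
Definition X_image (a : R) (I : R -> Prop) (p : point) : Prop :=
  exists s th, I s /\ 0 <= th <= 2 * PI /\ p = X a s th.

Definition catenoid (a : R) : point -> Prop := X_image a (fun _ => True).

(** * Domains and stability *)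

Definition compact_set (K : point -> Prop) : Prop :=
  forall (J : Type) (U : J -> point -> Prop),
    (forall j, open (U j)) ->
    (forall p, K p -> exists j, U j p) ->
    exists l : list J, forall p, K p -> exists j, In j l /\ U j p.

Definition connected_set (D : point -> Prop) : Prop :=
  forall U V : point -> Prop,
    open U -> open V ->
    (forall p, D p -> U p \/ V p) ->
    (forall p, ~ (D p /\ U p /\ V p)) ->
    (exists p, D p /\ U p) -> (exists p, D p /\ V p) -> False.

Definition relatively_open (M D : point -> Prop) : Prop :=
  exists U : point -> Prop, open U /\ forall p, D p <-> M p /\ U p.

(** "Domain" has to include connectedness: with arbitrary open sets, adding to
    {s > -l} a far away disjoint stable piece of {s < -l} would again give a
    weakly stable set, and no maximality could hold. *)
Definition open_domain (a : R) (D : point -> Prop) : Prop :=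
  relatively_open (catenoid a) D /\ connected_set D.

(** Only the values of [f] on the catenoid matter. As [X a] is a local
    diffeomorphism from R^2 onto the catenoid, [f] is smooth on the catenoid iff
    its pull-back is smooth on R^2. *)
Definition pullback (a : R) (f : point -> R) (s th : R) : R := f (X a s th).

Definition smooth_on_catenoid (a : R) (f : point -> R) : Prop :=
  forall n s th, ex_diff_n (pullback a f) n s th.

Definition compactly_supported_in (a : R) (f : point -> R) (D : point -> Prop)
    : Prop :=
  exists K : point -> Prop,
    compact_set K /\ (forall p, K p -> D p) /\
    (forall p, catenoid a p -> ~ K p -> f p = 0).

(** To be used for relatively open [D], which are their own interior. *)
Definition weakly_stable (a : R) (D : point -> Prop) : Prop :=
  forall f : point -> R,
    smooth_on_catenoid a f -> compactly_supported_in a f D ->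
    0 <= surface_integral (X a) (fun s th =>
           pullback a f s th * jacobi_op (X a) (pullback a f) s th).

Definition strictly_larger (D' D : point -> Prop) : Prop :=
  (forall p, D p -> D' p) /\ (exists p, D' p /\ ~ D p).

Definition maximally_weakly_stable (a : R) (D : point -> Prop) : Prop :=
  weakly_stable a D /\
  forall D', open_domain a D' -> strictly_larger D' D -> ~ weakly_stable a D'.

Definition rotate (phi : R) (p : point) : point :=
  let '(x, y, t) := p in
  (cos phi * x - sin phi * y, sin phi * x + cos phi * y, t).

Definition rotation_invariant (D : point -> Prop) : Prop :=
  forall phi p, D p -> D (rotate phi p).

Definition maximally_weakly_stable_rot (a : R) (D : point -> Prop) : Prop :=
  weakly_stable a D /\
  forall D', open_domain a D' -> rotation_invariant D' ->
    strictly_larger D' D -> ~ weakly_stable a D'.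

Definition D_plus (a : R) : point -> Prop := X_image a (fun s => 0 < s).
Definition D_minus (a : R) : point -> Prop := X_image a (fun s => s < 0).
Definition D_prime (a l : R) : point -> Prop := X_image a (fun s => - l < s).

Definition Lindelof_property (a : R) : Prop :=
  maximally_weakly_stable_rot a (D_plus a).

(* Main.v *)
Require Import Defs.
From Stdlib Require Import Reals Lra List Factorial FunctionalExtensionality.
From Stdlib Require Import ClassicalEpsilon IndefiniteDescription.
From Coquelicot Require Import Coquelicot.
Open Scope R_scope.

(** Write [W] for [cosh a ^ 2 * cosh s ^ 2 - 1], the square of [sinh] of the
    radius. In the parameters [(s, th)] the induced metric of the catenoid is
    [ds ^ 2 + W dth ^ 2], and the Jacobi operator is computed directly from the
    curvature of the disk model and the second fundamental form ([jacobi_opE]):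
    it sends [u] to [- (sqrt W u_s)_s / sqrt W - u_thth / W - q u], with the
    potential [q = sinh a ^ 2 (cosh a ^ 2 cosh s ^ 2 + 1) / W ^ 2].

    Two rotationally invariant solutions of the Jacobi equation are explicit:
    the odd function [v], coming from vertical translations, and the even
    function [e], coming from the variation of [a]. The question of stability is
    read off from the quotient [m = e / v] on the positive half-line. It
    decreases strictly from [+ infinity] to [- E], where [E > 0] is the limit at
    infinity of the derivative of the height in [a]; that [E] is finite is where
    hyperbolic geometry enters, as for the Euclidean catenoid the corresponding
    limit is infinite. So [m] takes the value [0] at a unique [z] and the value
    [E] at a unique [l], and [0 < l < z].

    The solution [w = E v + e] vanishes at [- l] and is positive on
    [s > - l]: there [w / v] is [E + m(s)] for [s > 0] and [E - m(- s)] for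
    [s < 0]. A positive solution makes a domain weakly stable: by Picone's
    identity, the stability form of a function [u] supported in the domain is
    the integral of [sqrt W (u_s - u w_s / w) ^ 2 + u_th ^ 2 / sqrt W], up to
    exact derivatives ([weakly_stable_of_positive_solution]). As [l > 0], the
    upper half of the catenoid is thus contained in a strictly larger weakly
    stable domain, and so is the lower half by reflection.

    Conversely, a larger invariant domain contains the whole part [s >= b] for
    some [b < - l]. Take [l'] between [l] and [- b]; the solution [w = m(l') v + e]
    is negative and bounded away from [0] outside a compact interval
    [[b, c]], because [m(l') < E]. Hence, for [K] large, [U = 1 + K w] is
    nonpositive outside that interval. Since [J U = - q < 0], the function
    [phi(U)] with [phi(x) = x exp(- 1 / x)] for [x > 0], extended by [0], is a
    smooth compactly supported function with negative stability form
    ([not_weakly_stable_of_containing]). So the domain [s > - l] is maximal;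
    as these domains are nested, no other one is. *)

(** * Hyperbolic functions and the profile of the catenoid *)

Lemma cosh_pow2 (x : R) : cosh x ^ 2 = 1 + sinh x ^ 2.
Proof.
unfold cosh, sinh; rewrite exp_Ropp.
assert (H := exp_pos x); field; lra.
Qed.

Lemma sinh_gt0 (x : R) : 0 < x -> 0 < sinh x.
Proof. intros H; rewrite <- sinh_0; apply sinh_lt, H. Qed.

Lemma sinh_opp (x : R) : sinh (- x) = - sinh x.
Proof. unfold sinh; rewrite Ropp_involutive; field. Qed.

Lemma cosh_opp (x : R) : cosh (- x) = cosh x.
Proof. unfold cosh; rewrite Ropp_involutive; field. Qed.

Lemma cosh_gt0 (x : R) : 0 < cosh x.
Proof.
unfold cosh; assert (H := exp_pos x); assert (H' := exp_pos (- x)); lra.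
Qed.

Lemma cosh_ge1 (x : R) : 1 <= cosh x.
Proof.
assert (H := cosh_gt0 x); assert (E := cosh_pow2 x).
assert (0 <= sinh x ^ 2) by apply pow2_ge_0; nra.
Qed.

Lemma cosh_gt1 (x : R) : 0 < x -> 1 < cosh x.
Proof.
intros Hx; assert (H := cosh_gt0 x); assert (E := cosh_pow2 x).
assert (0 < sinh x ^ 2) by apply pow_lt, sinh_gt0, Hx; nra.
Qed.

Lemma cosh_le (x y : R) : 0 <= x <= y -> cosh x <= cosh y.
Proof.
intros H; assert (Hx := cosh_gt0 x); assert (Hy := cosh_gt0 y).
assert (E := cosh_pow2 x); assert (E' := cosh_pow2 y).
assert (0 <= sinh x).
{ destruct (proj1 H) as [h | <-]; [left; apply sinh_gt0, h | rewrite sinh_0; lra]. }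
assert (sinh x <= sinh y).
{ destruct (proj2 H) as [h | ->]; [left; apply sinh_lt, h | lra]. }
nra.
Qed.

(** This is [sinh (radius a s) ^ 2]: a parallel has length [2 * PI * sqrt (W a s)]. *)
Definition W (a s : R) : R := cosh a ^ 2 * cosh s ^ 2 - 1.

Lemma coshcosh_gt1 (a s : R) : 0 < a -> 1 < cosh a * cosh s.
Proof.
intros Ha; assert (H := cosh_gt1 a Ha); assert (H' := cosh_ge1 s); nra.
Qed.

Lemma W_gt0 (a s : R) : 0 < a -> 0 < W a s.
Proof. intros Ha; assert (H := coshcosh_gt1 a s Ha); unfold W; nra. Qed.

Lemma sqrtW_gt0 (a s : R) : 0 < a -> 0 < sqrt (W a s).
Proof. intros Ha; apply sqrt_lt_R0, W_gt0, Ha. Qed.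

Lemma sqrtW_pow2 (a s : R) : 0 < a -> sqrt (W a s) ^ 2 = W a s.
Proof. intros Ha; apply pow2_sqrt; left; apply W_gt0, Ha. Qed.

Lemma W_opp (a s : R) : W a (- s) = W a s.
Proof. unfold W; rewrite cosh_opp; reflexivity. Qed.

Lemma W_split (a s : R) : W a s = cosh a ^ 2 * sinh s ^ 2 + sinh a ^ 2.
Proof. unfold W; rewrite (cosh_pow2 s), (cosh_pow2 a); ring. Qed.

Lemma is_derive_W (a s : R) :
  is_derive (W a) s (2 * cosh a ^ 2 * cosh s * sinh s).
Proof. unfold W; auto_derive; [trivial | ring]. Qed.

(** Lets [auto_derive] differentiate through [W] without unfolding it. *)
#[local] Instance UnaryDiff_W (a : R) : UnaryDiff (W a) :=
  Build_UnaryDiff (W a) (fun s => 2 * cosh a ^ 2 * cosh s * sinh s)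
    (is_derive_W a).

Lemma is_derive_sqrtW (a s : R) : 0 < a ->
  is_derive (fun u => sqrt (W a u)) s
    (cosh a ^ 2 * cosh s * sinh s / sqrt (W a s)).
Proof.
intros Ha; auto_derive; [apply W_gt0, Ha|].
field; apply Rgt_not_eq, sqrtW_gt0, Ha.
Qed.

(** With [z = exp (arcosh x)], the half-angle gives [(z - 1) / (z + 1)]. *)
Lemma tanh_half_arcosh (x : R) : 1 <= x ->
  tanh (arcosh x / 2) = sqrt (x ^ 2 - 1) / (x + 1).
Proof.
intros Hx; assert (Hs := sqrt_pos (x ^ 2 - 1)).
assert (Hq : sqrt (x ^ 2 - 1) ^ 2 = x ^ 2 - 1) by (apply pow2_sqrt; nra).
assert (E : exp (arcosh x / 2) ^ 2 = x + sqrt (x ^ 2 - 1)).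
{ replace (exp (arcosh x / 2) ^ 2) with (exp (arcosh x)).
  - unfold arcosh; apply exp_ln; lra.
  - simpl; rewrite Rmult_1_r, <- exp_plus; f_equal; field. }
assert (Hp := exp_pos (arcosh x / 2)).
unfold tanh, sinh, cosh; rewrite exp_Ropp.
set (z := exp (arcosh x / 2)) in *; set (y := sqrt (x ^ 2 - 1)) in *.
transitivity ((z ^ 2 - 1) / (z ^ 2 + 1)).
- field; split; nra.
- rewrite E; apply (Rmult_eq_reg_r ((x + y + 1) * (x + 1))); [|nra].
  field_simplify; [nra | lra | lra].
Qed.

Lemma is_derive_arcosh (x : R) : 1 < x ->
  is_derive arcosh x (/ sqrt (x ^ 2 - 1)).
Proof.
intros Hx; assert (Hs : 0 < sqrt (x ^ 2 - 1)) by (apply sqrt_lt_R0; nra).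
unfold arcosh; auto_derive.
- replace (x * (x * 1) + - (1)) with (x ^ 2 - 1) by ring.
  repeat split; nra.
- replace (x * (x * 1) + - (1)) with (x ^ 2 - 1) by ring.
  field; lra.
Qed.

Lemma is_derive_radius (a s : R) : 0 < a ->
  is_derive (radius a) s (cosh a * sinh s / sqrt (W a s)).
Proof.
intros Ha; assert (Hx := coshcosh_gt1 a s Ha).
assert (H := is_derive_arcosh _ Hx).
replace ((cosh a * cosh s) ^ 2 - 1) with (W a s) in H by (unfold W; ring).
unfold radius.
replace (cosh a * sinh s / sqrt (W a s)) with
  (scal (cosh a * sinh s) (/ sqrt (W a s))) by reflexivity.
apply (is_derive_comp arcosh (fun u => cosh a * cosh u)); [exact H|].
auto_derive; [trivial | ring].
Qed.

Lemma is_derive_radius_param (a s : R) : 0 < a ->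
  is_derive (fun b => radius b s) a (sinh a * cosh s / sqrt (W a s)).
Proof.
intros Ha; assert (Hx := coshcosh_gt1 a s Ha).
assert (H := is_derive_arcosh _ Hx).
replace ((cosh a * cosh s) ^ 2 - 1) with (W a s) in H by (unfold W; ring).
unfold radius.
replace (sinh a * cosh s / sqrt (W a s)) with
  (scal (sinh a * cosh s) (/ sqrt (W a s))) by reflexivity.
apply (is_derive_comp arcosh (fun u => cosh u * cosh s)); [exact H|].
auto_derive; [trivial | ring].
Qed.

Lemma continuous_inv_sqrtW (a s : R) : 0 < a ->
  continuous (fun t => / sqrt (W a t)) s.
Proof.
intros Ha; apply (ex_derive_continuous (V := R_NormedModule)).
eexists; apply is_derive_inv;
  [apply is_derive_sqrtW, Ha | apply Rgt_not_eq, sqrtW_gt0, Ha].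
Qed.

Lemma is_derive_RInt_0 (g : R -> R) (s : R) : (forall t, continuous g t) ->
  is_derive (fun u => RInt g 0 u) s (g s).
Proof.
intros Hg; apply (is_derive_RInt g (fun u => RInt g 0 u) 0 s); [|apply Hg].
exists (mkposreal 1 Rlt_0_1); intros u _.
apply (RInt_correct (V := R_CompleteNormedModule)).
apply (ex_RInt_continuous (V := R_CompleteNormedModule)); intros; apply Hg.
Qed.

Lemma is_derive_Lambda (a s : R) : 0 < a ->
  is_derive (Lambda a) s (sinh a / sqrt (W a s)).
Proof.
intros Ha; unfold Lambda, Rdiv; apply (is_derive_scal _ s (sinh a)).
apply (is_derive_RInt_0 (fun t => / sqrt (W a t))).
intros t; apply continuous_inv_sqrtW, Ha.
Qed.

Lemma Lambda_incr (a s t : R) : 0 < a -> s < t -> Lambda a s < Lambda a t.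
Proof.
intros Ha Hst.
apply (incr_function (Lambda a) m_infty p_infty
  (fun u => sinh a / sqrt (W a u))); try exact I; try exact Hst.
- intros u _ _; apply is_derive_Lambda, Ha.
- intros u _ _; apply Rdiv_lt_0_compat; [apply sinh_gt0, Ha | apply sqrtW_gt0, Ha].
Qed.

Lemma Lambda_lt_inv (a s t : R) : 0 < a -> Lambda a s < Lambda a t -> s < t.
Proof.
intros Ha H; destruct (Rtotal_order s t) as [h | [-> | h]]; [exact h | lra |].
apply (Lambda_incr a) in h; [lra | exact Ha].
Qed.

Lemma Lambda_inj (a s t : R) : 0 < a -> Lambda a s = Lambda a t -> s = t.
Proof.
intros Ha H; destruct (Rtotal_order s t) as [h | [h | h]]; [| exact h |];
  apply (Lambda_incr a) in h; lra.
Qed.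

(** * The variation Jacobi field *)

(** The integrand of the derivative of [Lambda] with respect to [a]. *)
Definition height_var_density (a t : R) : R := cosh a * sinh t ^ 2 / sqrt (W a t) ^ 3.

Definition height_var (a s : R) : R := RInt (height_var_density a) 0 s.

Lemma continuous_height_var_density (a s : R) : 0 < a -> continuous (height_var_density a) s.
Proof.
intros Ha; apply (ex_derive_continuous (V := R_NormedModule)).
assert (H' := sqrtW_gt0 a s Ha); unfold height_var_density; auto_derive; repeat split.
- apply W_gt0, Ha.
- apply Rgt_not_eq; fold ((sqrt (W a s)) ^ 3); apply pow_lt, H'.
Qed.

Lemma is_derive_height_var (a s : R) : 0 < a -> is_derive (height_var a) s (height_var_density a s).
Proof.
intros Ha; apply is_derive_RInt_0; intros t; apply continuous_height_var_density, Ha.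
Qed.

Lemma continuity_2d_of_continuous (f : R -> R) (x y : R) :
  continuous f x -> continuity_2d_pt (fun u _ => f u) x y.
Proof.
intros H; apply (continuity_1d_2d_pt_comp f (fun u _ => u)).
- apply continuity_pt_filterlim, H.
- apply continuity_2d_pt_id1.
Qed.

Lemma continuity_2d_of_continuous_r (f : R -> R) (x y : R) :
  continuous f y -> continuity_2d_pt (fun _ v => f v) x y.
Proof.
intros H; apply (continuity_1d_2d_pt_comp f (fun _ v => v)).
- apply continuity_pt_filterlim, H.
- apply continuity_2d_pt_id2.
Qed.

Lemma continuous_cosh (x : R) : continuous cosh x.
Proof.
apply (ex_derive_continuous (V := R_NormedModule)); auto_derive; trivial.
Qed.

Lemma continuous_sinh (x : R) : continuous sinh x.
Proof.
apply (ex_derive_continuous (V := R_NormedModule)); auto_derive; trivial.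
Qed.

Lemma is_derive_invsqrtW_param (a t : R) : 0 < a ->
  is_derive (fun b => / sqrt (W b t)) a
    (- (cosh a * sinh a * cosh t ^ 2 / sqrt (W a t) ^ 3)).
Proof.
intros Ha; assert (Hw := W_gt0 a t Ha); unfold W in *.
assert (Hs := sqrt_lt_R0 _ Hw).
auto_derive.
- replace (cosh a * (cosh a * 1) * (cosh t * (cosh t * 1)) + - (1))
    with (cosh a ^ 2 * cosh t ^ 2 - 1) by ring; split; [lra|].
  split; [lra | trivial].
- replace (cosh a * (cosh a * 1) * (cosh t * (cosh t * 1)) + - (1))
    with (cosh a ^ 2 * cosh t ^ 2 - 1) by ring.
  field; lra.
Qed.

(** Differentiation under the integral sign; the two resulting integrals combine
    because [W - sinh a ^ 2 * cosh t ^ 2 = sinh t ^ 2]. *)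
Lemma is_derive_Lambda_param (a s : R) : 0 < a ->
  is_derive (fun b => Lambda b s) a (height_var a s).
Proof.
intros Ha.
assert (Hd : is_derive (fun b => RInt (fun t => / sqrt (W b t)) 0 s) a
  (RInt (fun t => - (cosh a * sinh a * cosh t ^ 2 / sqrt (W a t) ^ 3)) 0 s)).
{ assert (Hpos : locally a (fun b => 0 < b)).
  { exists (mkposreal a Ha); intros b Hb.
    unfold ball in Hb; simpl in Hb; unfold AbsRing_ball, abs, minus, plus, opp in Hb;
    simpl in Hb; apply Rabs_def2 in Hb; lra. }
  rewrite (RInt_ext _ (fun t => Derive (fun b => / sqrt (W b t)) a)).
  2:{ intros t _; symmetry; apply is_derive_unique, is_derive_invsqrtW_param, Ha. }
  apply (is_derive_RInt_param (fun b t => / sqrt (W b t))).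
  - apply (filter_imp (fun b => 0 < b)); [|exact Hpos]; intros b Hb t _.
    eexists; apply is_derive_invsqrtW_param, Hb.
  - intros t _.
    apply (continuity_2d_pt_ext_loc
      (fun b t => - (cosh b * sinh b * cosh t ^ 2 / sqrt (W b t) ^ 3))).
    + destruct Hpos as [d Hd]; exists d; intros u u' Hu _.
      symmetry; apply is_derive_unique, is_derive_invsqrtW_param, Hd, Hu.
    + apply continuity_2d_pt_opp; unfold Rdiv.
      assert (C1 : continuity_2d_pt (fun u _ => cosh u) a t)
        by apply continuity_2d_of_continuous, continuous_cosh.
      assert (C2 : continuity_2d_pt (fun u _ => sinh u) a t)
        by apply continuity_2d_of_continuous, continuous_sinh.
      assert (C3 : continuity_2d_pt (fun _ u => cosh u ^ 2) a t).
      { apply (continuity_2d_of_continuous_r (fun u => cosh u ^ 2)).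
        apply (ex_derive_continuous (V := R_NormedModule)); auto_derive; trivial. }
      assert (C4 : continuity_2d_pt (fun u v => sqrt (W u v)) a t).
      { apply (continuity_1d_2d_pt_comp sqrt).
        - apply continuity_pt_sqrt; left; apply W_gt0, Ha.
        - unfold W; apply continuity_2d_pt_minus; [|apply continuity_2d_pt_const].
          apply continuity_2d_pt_mult; [|exact C3].
          apply (continuity_2d_of_continuous (fun u => cosh u ^ 2)).
          apply (ex_derive_continuous (V := R_NormedModule)); auto_derive; trivial. }
      repeat first [assumption | apply continuity_2d_pt_mult].
      apply continuity_2d_pt_inv.
      * simpl; repeat first [assumption | apply continuity_2d_pt_const |
          apply continuity_2d_pt_mult].
      * apply Rgt_not_eq, pow_lt, sqrtW_gt0, Ha.
  - apply (filter_imp (fun b => 0 < b)); [|exact Hpos]; intros b Hb.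
    apply (ex_RInt_continuous (V := R_CompleteNormedModule)); intros t _.
    apply continuous_inv_sqrtW, Hb. }
assert (Hprod : is_derive (fun b => Lambda b s) a
  (cosh a * RInt (fun t => / sqrt (W a t)) 0 s + sinh a *
   RInt (fun t => - (cosh a * sinh a * cosh t ^ 2 / sqrt (W a t) ^ 3)) 0 s)).
{ unfold Lambda.
  apply (is_derive_mult sinh (fun b => RInt (fun t => / sqrt (W b t)) 0 s) a);
    [auto_derive; [trivial | ring] | exact Hd | intros; apply Rmult_comm]. }
replace (height_var a s) with (cosh a * RInt (fun t => / sqrt (W a t)) 0 s + sinh a *
   RInt (fun t => - (cosh a * sinh a * cosh t ^ 2 / sqrt (W a t) ^ 3)) 0 s);
  [exact Hprod|].
assert (I1 : ex_RInt (fun t => / sqrt (W a t)) 0 s).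
{ apply (ex_RInt_continuous (V := R_CompleteNormedModule)); intros t _.
  apply continuous_inv_sqrtW, Ha. }
assert (I2 : ex_RInt (fun t => - (cosh a * sinh a * cosh t ^ 2 / sqrt (W a t) ^ 3)) 0 s).
{ apply (ex_RInt_continuous (V := R_CompleteNormedModule)); intros t _.
  apply (ex_derive_continuous (V := R_NormedModule)).
  assert (H' := sqrtW_gt0 a t Ha); auto_derive; repeat split.
  - apply W_gt0, Ha.
  - apply Rgt_not_eq; fold ((sqrt (W a t)) ^ 3); apply pow_lt, H'. }
symmetry; unfold height_var.
rewrite (RInt_ext (height_var_density a) (fun t => plus (scal (cosh a) (/ sqrt (W a t)))
  (scal (sinh a) (- (cosh a * sinh a * cosh t ^ 2 / sqrt (W a t) ^ 3))))).
- rewrite (RInt_plus (V := R_CompleteNormedModule)).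
  + rewrite !(RInt_scal (V := R_CompleteNormedModule)) by assumption; reflexivity.
  + apply (ex_RInt_scal (V := R_NormedModule)), I1.
  + apply (ex_RInt_scal (V := R_NormedModule)), I2.
- intros t _; unfold plus, scal; simpl; unfold mult; simpl; unfold height_var_density.
  assert (H' := sqrtW_gt0 a t Ha); 
  assert (E : sqrt (W a t) ^ 2 = cosh a ^ 2 * sinh t ^ 2 + sinh a ^ 2)
    by (rewrite <- W_split; apply sqrtW_pow2, Ha).
  transitivity ((cosh a * sqrt (W a t) ^ 2 - cosh a * sinh a ^ 2 * cosh t ^ 2)
    / sqrt (W a t) ^ 3); [|field; lra].
  rewrite E, (cosh_pow2 t).
  replace (cosh a * (cosh a ^ 2 * sinh t ^ 2 + sinh a ^ 2) -
    cosh a * sinh a ^ 2 * (1 + sinh t ^ 2))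
    with (cosh a * (cosh a ^ 2 - sinh a ^ 2) * sinh t ^ 2) by ring.
  rewrite (cosh_pow2 a); field; lra.
Qed.

(** The vertical component of the unit normal, equal to the derivative of the
    radius: it is the Jacobi field of the vertical translations. *)
Definition jacobi_v (a s : R) : R := cosh a * sinh s / sqrt (W a s).

Definition jacobi_e (a s : R) : R :=
  sinh a ^ 2 * cosh s / W a s - jacobi_v a s * height_var a s.

Lemma e_jacobi_e (a s : R) : 0 < a -> e a s = jacobi_e a s.
Proof.
intros Ha; unfold e.
replace (Derive (fun u => Lambda a u) s) with (sinh a / sqrt (W a s))
  by (symmetry; apply is_derive_unique, is_derive_Lambda, Ha).
replace (Derive (fun b => radius b s) a) with (sinh a * cosh s / sqrt (W a s))
  by (symmetry; apply is_derive_unique, is_derive_radius_param, Ha).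
replace (Derive (fun b => Lambda b s) a) with (height_var a s)
  by (symmetry; apply is_derive_unique, is_derive_Lambda_param, Ha).
replace (Derive (fun u => radius a u) s) with (jacobi_v a s)
  by (symmetry; apply is_derive_unique, is_derive_radius, Ha).
unfold jacobi_e, jacobi_v.
replace (sinh a ^ 2 * cosh s / W a s)
  with (sinh a ^ 2 * cosh s / sqrt (W a s) ^ 2)
  by (rewrite sqrtW_pow2 by exact Ha; reflexivity).
field; apply Rgt_not_eq, sqrtW_gt0, Ha.
Qed.

(** * Rotationally invariant Jacobi fields *)

(** The sum of [Ric(N, N)] and the squared norm of the second fundamental form. *)
Definition potential (a s : R) : R :=
  sinh a ^ 2 * (cosh a ^ 2 * cosh s ^ 2 + 1) / W a s ^ 2.

(** Up to a factor, every rotationally invariant Jacobi field other than the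
    multiples of [jacobi_v] has this form, with value [1] at [s = 0]. *)
Definition jacobi_comb (a mu s : R) : R := mu * jacobi_v a s + jacobi_e a s.

Definition djacobi_comb (a mu s : R) : R :=
  (mu - height_var a s) * (sinh a ^ 2 * cosh a * cosh s / sqrt (W a s) ^ 3) -
  sinh s * (cosh a ^ 4 * cosh s ^ 2 - 1) / sqrt (W a s) ^ 4.

Lemma is_derive_jacobi_comb (a mu s : R) : 0 < a ->
  is_derive (jacobi_comb a mu) s (djacobi_comb a mu s).
Proof.
intros Ha; assert (Hw := W_gt0 a s Ha); assert (Hy := sqrtW_gt0 a s Ha).
assert (HB := is_derive_height_var a s Ha).
unfold jacobi_comb, jacobi_e, jacobi_v; auto_derive.
- repeat split; try assumption; try lra. eexists; exact HB.
- replace (Derive (fun x => height_var a x) s) with (height_var_density a s)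
    by (symmetry; apply is_derive_unique, HB).
  unfold height_var_density, djacobi_comb.
  assert (E := sqrtW_pow2 a s Ha).
  assert (E' : W a s = cosh a ^ 2 * cosh s ^ 2 - 1) by reflexivity.
  assert (Ea : sinh a ^ 2 = cosh a ^ 2 - 1) by (rewrite cosh_pow2; ring).
  assert (Es : sinh s ^ 2 = cosh s ^ 2 - 1) by (rewrite cosh_pow2; ring).
  set (Y := sqrt (W a s)) in *.
  rewrite <- E in *; clear Hw; clearbody Y.
  field_simplify_eq; [|lra].
  ring [E' Ea Es].
Qed.

(** The Jacobi equation in divergence form. Both deformations of the catenoid run
    through minimal surfaces, so their normal components solve it; with
    the explicit formulas it becomes an algebraic identity. *)
Lemma is_derive_flux_jacobi_comb (a mu s : R) : 0 < a ->
  is_derive (fun u => sqrt (W a u) * djacobi_comb a mu u) s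
    (- sqrt (W a s) * potential a s * jacobi_comb a mu s).
Proof.
intros Ha; assert (Hw := W_gt0 a s Ha); assert (Hy := sqrtW_gt0 a s Ha).
assert (HB := is_derive_height_var a s Ha).
unfold djacobi_comb; auto_derive.
- repeat split; try assumption; try (eexists; exact HB);
    apply Rgt_not_eq; repeat first [lra | apply Rmult_lt_0_compat].
- replace (Derive (fun x => height_var a x) s) with (height_var_density a s)
    by (symmetry; apply is_derive_unique, HB).
  unfold height_var_density, jacobi_comb, jacobi_e, jacobi_v, potential.
  assert (E := sqrtW_pow2 a s Ha).
  assert (E' : W a s = cosh a ^ 2 * cosh s ^ 2 - 1) by reflexivity.
  assert (Ea : sinh a ^ 2 = cosh a ^ 2 - 1) by (rewrite cosh_pow2; ring).
  assert (Es : sinh s ^ 2 = cosh s ^ 2 - 1) by (rewrite cosh_pow2; ring).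
  set (Y := sqrt (W a s)) in *.
  rewrite <- E in *; clear Hw; clearbody Y.
  field_simplify_eq; [|lra].
  ring [E' Ea Es].
Qed.

Lemma continuous_jacobi_comb (a mu s : R) : 0 < a -> continuous (jacobi_comb a mu) s.
Proof.
intros Ha; apply (ex_derive_continuous (V := R_NormedModule)).
eexists; apply is_derive_jacobi_comb, Ha.
Qed.

(** * The quotient of the two Jacobi fields *)

(** The quotient [jacobi_e / jacobi_v], away from [0]. *)
Definition jacobi_ratio (a s : R) : R :=
  sinh a ^ 2 * (cosh s / (cosh a * sinh s * sqrt (W a s))) - height_var a s.

Lemma jacobi_e_factor (a s : R) : 0 < a -> s <> 0 ->
  jacobi_e a s = jacobi_v a s * jacobi_ratio a s.
Proof.
intros Ha Hs; assert (Hy := sqrtW_gt0 a s Ha); assert (Hc := cosh_gt0 a).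
assert (sinh s <> 0).
{ destruct (Rtotal_order s 0) as [h | [h | h]]; [|lra|].
  - apply sinh_lt in h; rewrite sinh_0 in h; lra.
  - apply sinh_gt0 in h; lra. }
unfold jacobi_e, jacobi_v, jacobi_ratio.
replace (sinh a ^ 2 * cosh s / W a s)
  with (sinh a ^ 2 * cosh s / sqrt (W a s) ^ 2)
  by (rewrite sqrtW_pow2 by exact Ha; reflexivity).
field; repeat split; lra.
Qed.

Lemma jacobi_v_gt0 (a s : R) : 0 < a -> 0 < s -> 0 < jacobi_v a s.
Proof.
intros Ha Hs; unfold jacobi_v; apply Rdiv_lt_0_compat; [|apply sqrtW_gt0, Ha].
apply Rmult_lt_0_compat; [apply cosh_gt0 | apply sinh_gt0, Hs].
Qed.

Lemma jacobi_v_opp (a s : R) : jacobi_v a (- s) = - jacobi_v a s.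
Proof. unfold jacobi_v; rewrite W_opp, sinh_opp; unfold Rdiv; ring. Qed.

Lemma ex_RInt_height_var_density (a s t : R) : 0 < a -> ex_RInt (height_var_density a) s t.
Proof.
intros Ha; apply (ex_RInt_continuous (V := R_CompleteNormedModule)).
intros u _; apply continuous_height_var_density, Ha.
Qed.

Lemma height_var_density_opp (a t : R) : height_var_density a (- t) = height_var_density a t.
Proof.
unfold height_var_density; rewrite W_opp, sinh_opp.
replace ((- sinh t) ^ 2) with (sinh t ^ 2) by ring; reflexivity.
Qed.

(** The integrand is even. *)
Lemma height_var_opp (a s : R) : 0 < a -> height_var a (- s) = - height_var a s.
Proof.
intros Ha; unfold height_var; rewrite <- Ropp_0 at 1.
rewrite <- (RInt_opp (V := R_CompleteNormedModule)) by apply ex_RInt_height_var_density, Ha.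
symmetry; apply is_RInt_unique.
apply (is_RInt_ext (fun t => opp (height_var_density a (- t)))).
- intros t _; rewrite height_var_density_opp; reflexivity.
- apply (is_RInt_comp_opp (V := R_NormedModule)).
  apply (RInt_correct (V := R_CompleteNormedModule)), ex_RInt_height_var_density, Ha.
Qed.

Lemma jacobi_e_opp (a s : R) : 0 < a -> jacobi_e a (- s) = jacobi_e a s.
Proof.
intros Ha; unfold jacobi_e; rewrite W_opp, cosh_opp, jacobi_v_opp, height_var_opp by exact Ha.
ring.
Qed.

Lemma height_var_density_gt0 (a t : R) : 0 < a -> 0 < t -> 0 < height_var_density a t.
Proof.
intros Ha Ht; unfold height_var_density; apply Rdiv_lt_0_compat.
- apply Rmult_lt_0_compat; [apply cosh_gt0 | apply pow_lt, sinh_gt0, Ht].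
- apply pow_lt, sqrtW_gt0, Ha.
Qed.

Lemma height_var_gt0 (a s : R) : 0 < a -> 0 < s -> 0 < height_var a s.
Proof.
intros Ha Hs; apply RInt_gt_0; [exact Hs | |].
- intros t Ht; apply height_var_density_gt0; [exact Ha | apply Ht].
- intros t _; apply continuous_height_var_density, Ha.
Qed.

Lemma height_var_incr (a s t : R) : 0 < a -> 0 < s < t -> height_var a s < height_var a t.
Proof.
intros Ha [Hs Hst].
apply (incr_function (height_var a) 0 p_infty (height_var_density a)); try exact I; try assumption.
- intros u _ _; apply is_derive_height_var, Ha.
- intros u Hu _; apply height_var_density_gt0; [exact Ha | exact Hu].
Qed.

Lemma sqrtW_ge_sinh (a s : R) : 0 < a -> 0 <= sinh s ->
  cosh a * sinh s <= sqrt (W a s).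
Proof.
intros Ha Hs; assert (Hy := sqrtW_gt0 a s Ha); assert (E := sqrtW_pow2 a s Ha).
rewrite W_split in E at 2; assert (Hc := cosh_gt0 a).
assert (0 <= cosh a * sinh s) by nra.
assert (0 <= sinh a ^ 2) by apply pow2_ge_0.
nra.
Qed.

Lemma sqrtW_ge_cosh (a s : R) : 0 < a -> sinh a * cosh s <= sqrt (W a s).
Proof.
intros Ha; assert (Hy := sqrtW_gt0 a s Ha); assert (E := sqrtW_pow2 a s Ha).
unfold W in E at 2; assert (Hc := cosh_ge1 s); assert (Hh := sinh_gt0 a Ha).
rewrite cosh_pow2 in E.
assert (0 <= sinh a * cosh s) by nra.
nra.
Qed.

Lemma sqrtW_le_cosh (a s : R) : 0 < a -> sqrt (W a s) <= cosh a * cosh s.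
Proof.
intros Ha; assert (Hy := sqrtW_gt0 a s Ha); assert (E := sqrtW_pow2 a s Ha).
unfold W in E at 2; assert (Hc := coshcosh_gt1 a s Ha).
nra.
Qed.

(** The integrand is dominated by the derivative of
    [- / (sinh a ^ 2 * cosh s)]. *)
Lemma height_var_bounded (a s : R) : 0 < a -> 0 < s -> height_var a s <= / sinh a ^ 2.
Proof.
intros Ha Hs; assert (Hh := sinh_gt0 a Ha).
pose (F := fun t => - / (sinh a ^ 2 * cosh t)).
assert (HF : forall t, is_derive F t (sinh t / (sinh a ^ 2 * cosh t ^ 2))).
{ intros t; assert (Hc := cosh_gt0 t); unfold F; auto_derive; [|field; lra].
  apply Rgt_not_eq; repeat first [lra | apply Rmult_lt_0_compat]. }
assert (HC : forall t, continuous (fun u => sinh u / (sinh a ^ 2 * cosh u ^ 2)) t).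
{ intros t; assert (Hc := cosh_gt0 t).
  apply (ex_derive_continuous (V := R_NormedModule)); auto_derive.
  apply Rgt_not_eq; repeat first [lra | apply Rmult_lt_0_compat]. }
assert (HI : is_RInt (fun u => sinh u / (sinh a ^ 2 * cosh u ^ 2)) 0 s
  (minus (F s) (F 0))).
{ apply (is_RInt_derive F); intros; [apply HF | apply HC]. }
apply Rle_trans with (RInt (fun u => sinh u / (sinh a ^ 2 * cosh u ^ 2)) 0 s).
- unfold height_var; apply RInt_le; [lra | apply ex_RInt_height_var_density, Ha | eexists; exact HI |].
  intros t [Ht _]; unfold height_var_density.
  assert (Hst := sinh_gt0 t Ht).
  assert (H1 := sqrtW_ge_sinh a t Ha (Rlt_le _ _ Hst)).
  assert (H2 := sqrtW_ge_cosh a t Ha); assert (Hy := sqrtW_gt0 a t Ha).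
  assert (Hc := cosh_gt0 t); assert (Hca := cosh_gt0 a).
  set (Y := sqrt (W a t)) in *.
  apply (Rle_div_r _ (sinh t) (sinh a ^ 2 * cosh t ^ 2));
    [apply Rmult_lt_0_compat; apply pow_lt; lra|].
  replace (cosh a * sinh t ^ 2 / Y ^ 3 * (sinh a ^ 2 * cosh t ^ 2))
    with (sinh t * ((cosh a * sinh t) * (sinh a * cosh t) ^ 2 / Y ^ 3))
    by (field; lra).
  apply Rle_trans with (sinh t * 1); [|lra].
  apply Rmult_le_compat_l; [lra|].
  apply Rle_div_l; [apply pow_lt, Hy|].
  rewrite Rmult_1_l; replace (Y ^ 3) with (Y * Y ^ 2) by ring.
  apply Rmult_le_compat; [nra | apply pow2_ge_0 | exact H1 |].
  apply pow_incr; nra.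
- rewrite (is_RInt_unique _ _ _ _ HI); unfold F, minus, plus, opp; simpl.
  rewrite cosh_0, !Rmult_1_r, Ropp_involutive.
  assert (0 < / (sinh a * sinh a * cosh s)).
  { apply Rinv_0_lt_compat; assert (Hc := cosh_gt0 s).
    apply Rmult_lt_0_compat; [apply Rmult_lt_0_compat|]; assumption. }
  lra.
Qed.

(** As [jacobi_v] tends to [1] and the first term of [jacobi_e] to [0], this
    supremum is minus the limit of [jacobi_e a] at infinity. *)
Definition is_sup_height_var (a E : R) : Prop :=
  (forall s, 0 < s -> height_var a s <= E) /\
  (forall m, m < E -> exists s, 0 < s /\ m < height_var a s).

Lemma is_sup_height_var_ex (a : R) : 0 < a -> exists E, is_sup_height_var a E.
Proof.
intros Ha.
destruct (completeness (fun y => exists s, 0 < s /\ y = height_var a s)) as [E [H1 H2]].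
- exists (/ sinh a ^ 2); intros y [s [Hs ->]]; apply height_var_bounded; assumption.
- exists (height_var a 1), 1; split; [lra | reflexivity].
- exists E; split.
  + intros s Hs; apply H1; exists s; auto.
  + intros m Hm; apply Classical_Prop.NNPP; intros Hn.
    apply (Rlt_not_le _ _ Hm), H2; intros y [s [Hs ->]].
    apply Rnot_lt_le; intros Hlt; apply Hn; exists s; auto.
Qed.

Lemma sup_height_var_gt0 (a E : R) : 0 < a -> is_sup_height_var a E -> 0 < E.
Proof.
intros Ha [H _]; apply Rlt_le_trans with (height_var a 1);
  [apply height_var_gt0 | apply H]; lra.
Qed.

(** The first term is a product of the decreasing functions [cosh / sinh] and
    [/ sqrt W], and the integral subtracted from it increases. *)
Lemma jacobi_ratio_decr (a s t : R) : 0 < a -> 0 < s < t -> jacobi_ratio a t < jacobi_ratio a s.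
Proof.
intros Ha [Hs Hst]; unfold jacobi_ratio.
assert (HB := height_var_incr a s t Ha (conj Hs Hst)).
assert (Hss := sinh_gt0 s Hs); assert (Hlt := sinh_lt s t Hst).
assert (Hy := sqrtW_gt0 a s Ha); assert (Hy' := sqrtW_gt0 a t Ha).
assert (Hcc := cosh_le s t ltac:(lra)); assert (Hc := cosh_gt0 s).
assert (Hct := cosh_gt0 t); assert (Hca := cosh_gt0 a).
assert (Hyy : sqrt (W a s) <= sqrt (W a t)).
{ apply sqrt_le_1_alt; unfold W; apply Rplus_le_compat_r.
  apply Rmult_le_compat_l; [apply pow2_ge_0 | apply pow_incr; split; lra]. }
assert (Hcs : cosh t * sinh s <= cosh s * sinh t).
{ apply Rsqr_incr_0_var;
    [|left; apply Rmult_lt_0_compat; lra].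
  rewrite !Rsqr_mult, !Rsqr_pow2, (cosh_pow2 s), (cosh_pow2 t).
  assert (sinh s ^ 2 <= sinh t ^ 2) by (apply pow_incr; lra); lra. }
assert (cosh t / (cosh a * sinh t * sqrt (W a t)) <=
  cosh s / (cosh a * sinh s * sqrt (W a s))).
{ replace (cosh t / (cosh a * sinh t * sqrt (W a t)))
    with (/ cosh a * ((cosh t / sinh t) * / sqrt (W a t))) by (field; lra).
  replace (cosh s / (cosh a * sinh s * sqrt (W a s)))
    with (/ cosh a * ((cosh s / sinh s) * / sqrt (W a s))) by (field; lra).
  apply Rmult_le_compat_l; [left; apply Rinv_0_lt_compat, Hca|].
  apply Rmult_le_compat.
  - left; apply Rdiv_lt_0_compat; [apply cosh_gt0 | lra].
  - left; apply Rinv_0_lt_compat, Hy'.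
  - apply Rle_div_l; [lra|].
    replace (cosh s / sinh s * sinh t) with (cosh s * sinh t / sinh s)
      by (field; lra).
    apply (Rle_div_r (cosh t) (cosh s * sinh t) (sinh s)); lra.
  - apply Rinv_le_contravar; assumption. }
assert (0 <= sinh a ^ 2) by apply pow2_ge_0.
nra.
Qed.

Lemma jacobi_ratio_le (a s : R) : 0 < a -> 0 < s -> jacobi_ratio a s <= / sinh s - height_var a s.
Proof.
intros Ha Hs; unfold jacobi_ratio; apply Rplus_le_compat_r.
assert (Hss := sinh_gt0 s Hs); assert (Hh := sinh_gt0 a Ha).
assert (Hy := sqrtW_gt0 a s Ha); assert (H := sqrtW_ge_cosh a s Ha).
assert (Hca := cosh_gt0 a); assert (Hc := cosh_gt0 s).
assert (Hlt : sinh a <= cosh a) by (assert (E := cosh_pow2 a); nra).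
replace (sinh a ^ 2 * (cosh s / (cosh a * sinh s * sqrt (W a s))))
  with (/ sinh s * ((sinh a * (sinh a * cosh s)) / (cosh a * sqrt (W a s))))
  by (field; lra).
rewrite <- (Rmult_1_r (/ sinh s)) at 2; apply Rmult_le_compat_l;
  [left; apply Rinv_0_lt_compat, Hss|].
apply Rle_div_l; [nra|]; rewrite Rmult_1_l.
apply Rmult_le_compat; nra.
Qed.

Lemma jacobi_ratio_ge (a s : R) : 0 < a -> 0 < s ->
  sinh a ^ 2 / cosh a ^ 2 / sinh s - height_var a s <= jacobi_ratio a s.
Proof.
intros Ha Hs; unfold jacobi_ratio; apply Rplus_le_compat_r.
assert (Hss := sinh_gt0 s Hs); assert (H := sqrtW_le_cosh a s Ha).
assert (Hy := sqrtW_gt0 a s Ha).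
assert (Hca := cosh_gt0 a); assert (Hc := cosh_gt0 s).
unfold Rdiv at 1 2; rewrite !Rmult_assoc.
apply Rmult_le_compat_l; [apply pow2_ge_0|].
replace (cosh s / (cosh a * (sinh s * sqrt (W a s))))
  with (/ cosh a * / sinh s * (cosh s / sqrt (W a s))) by (field; lra).
replace (/ cosh a ^ 2 * / sinh s) with (/ cosh a * / sinh s * / cosh a)
  by (field; lra).
apply Rmult_le_compat_l.
- left; apply Rmult_lt_0_compat; apply Rinv_0_lt_compat; assumption.
- apply Rle_div_r; [exact Hy|].
  rewrite Rmult_comm; apply Rle_div_l; lra.
Qed.

Lemma jacobi_ratio_gt_opp_sup (a E s : R) : 0 < a -> is_sup_height_var a E -> 0 < s ->
  - E < jacobi_ratio a s.
Proof.
intros Ha [HE _] Hs; apply HE in Hs as H1; assert (H2 := jacobi_ratio_ge a s Ha Hs).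
assert (0 < sinh a ^ 2 / cosh a ^ 2 / sinh s).
{ apply Rdiv_lt_0_compat; [|apply sinh_gt0, Hs].
  apply Rdiv_lt_0_compat; apply pow_lt; [apply sinh_gt0, Ha | apply cosh_gt0]. }
lra.
Qed.

(** The first term of the ratio is at most [/ sinh s], which tends to [0]. *)
Lemma jacobi_ratio_large (a E mu : R) : 0 < a -> is_sup_height_var a E -> mu < E ->
  exists s, 0 < s /\ jacobi_ratio a s < - mu.
Proof.
intros Ha [_ HE] Hmu; destruct (HE mu Hmu) as [s0 [Hs0 Hb]].
pose (d := height_var a s0 - mu).
assert (Hd : 0 < d) by (unfold d; lra).
(* Beyond [arcsinh (2 / d)] the bound [/ sinh s] is below [d]. *)
exists (s0 + arcsinh (2 / d)).
assert (Ht : 0 < arcsinh (2 / d)).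
{ rewrite <- arcsinh_0; apply arcsinh_lt, Rdiv_lt_0_compat; lra. }
split; [lra|].
apply Rle_lt_trans with (1 := jacobi_ratio_le a (s0 + arcsinh (2 / d)) Ha ltac:(lra)).
assert (HB := height_var_incr a s0 (s0 + arcsinh (2 / d)) Ha ltac:(lra)).
assert (Hs : 2 / d < sinh (s0 + arcsinh (2 / d))).
{ rewrite <- (sinh_arcsinh (2 / d)) at 1; apply sinh_lt; lra. }
assert (/ sinh (s0 + arcsinh (2 / d)) < d); [|unfold d in *; lra].
apply Rlt_le_trans with (/ / d); [|rewrite Rinv_inv; lra].
apply Rinv_lt_contravar.
- apply Rmult_lt_0_compat; [apply Rinv_0_lt_compat, Hd|].
  apply sinh_gt0; lra.
- apply Rlt_trans with (2 := Hs); unfold Rdiv.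
  assert (0 < / d) by apply Rinv_0_lt_compat, Hd; lra.
Qed.

(** Near [0] the ratio behaves like [/ sinh s]. *)
Lemma jacobi_ratio_small (a E y : R) : 0 < a -> is_sup_height_var a E ->
  exists s, 0 < s /\ y < jacobi_ratio a s.
Proof.
intros Ha HE; pose (M := Rabs (y + E) + 1).
pose (b := sinh a ^ 2 / cosh a ^ 2).
assert (HM : 0 < M) by (unfold M; assert (H := Rabs_pos (y + E)); lra).
assert (Hb : 0 < b).
{ apply Rdiv_lt_0_compat; apply pow_lt; [apply sinh_gt0, Ha | apply cosh_gt0]. }
assert (HbM : 0 < b / M) by (apply Rdiv_lt_0_compat; assumption).
assert (Hs : 0 < arcsinh (b / M)) by (rewrite <- arcsinh_0; apply arcsinh_lt, HbM).
exists (arcsinh (b / M)); split; [exact Hs|].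
apply Rlt_le_trans with (2 := jacobi_ratio_ge a _ Ha Hs); rewrite sinh_arcsinh.
fold b; replace (b / (b / M)) with M by (field; lra).
assert (H := proj1 HE _ Hs); assert (H' := Rle_abs (y + E)).
assert (y + E < M) by (unfold M; lra); lra.
Qed.

Lemma continuity_pt_jacobi_ratio (a s : R) : 0 < a -> 0 < s -> continuity_pt (jacobi_ratio a) s.
Proof.
intros Ha Hs; apply continuity_pt_filterlim.
apply (ex_derive_continuous (V := R_NormedModule)); unfold jacobi_ratio.
assert (Hss := sinh_gt0 s Hs); assert (Hy := sqrtW_gt0 a s Ha).
assert (Hca := cosh_gt0 a).
auto_derive; repeat split.
- apply W_gt0, Ha.
- apply Rgt_not_eq; repeat first [lra | apply Rmult_lt_0_compat].
- eexists; apply is_derive_height_var, Ha.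
Qed.

Lemma jacobi_ratio_surj (a E y : R) : 0 < a -> is_sup_height_var a E -> - E < y ->
  exists s, 0 < s /\ jacobi_ratio a s = y.
Proof.
intros Ha HE Hy.
destruct (jacobi_ratio_large a E (- y) Ha HE) as [t [Ht Hqt]]; [lra|].
rewrite Ropp_involutive in Hqt.
destruct (jacobi_ratio_small a E y Ha HE) as [s [Hs Hqs]].
assert (Hst : s < t).
{ destruct (Rtotal_order s t) as [h | [<- | h]]; [exact h | lra |].
  assert (H := jacobi_ratio_decr a t s Ha (conj Ht h)); lra. }
destruct (Ranalysis5.IVT_interv (fun u => y - jacobi_ratio a u) s t) as [u [Hu E0]].
- intros u Hu; apply continuity_pt_minus.
  + apply continuity_pt_const; intros ? ?; reflexivity.
  + apply continuity_pt_jacobi_ratio; [exact Ha | lra].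
- exact Hst.
- lra.
- lra.
- exists u; split; lra.
Qed.

(** * Signs of the combinations of the two Jacobi fields *)

Lemma jacobi_comb_0 (a mu : R) : 0 < a -> jacobi_comb a mu 0 = 1.
Proof.
intros Ha; unfold jacobi_comb, jacobi_e, jacobi_v, W.
rewrite sinh_0, cosh_0; assert (H := sinh_gt0 a Ha).
replace (cosh a ^ 2 * 1 ^ 2 - 1) with (sinh a ^ 2) by (rewrite cosh_pow2; ring).
unfold Rdiv; rewrite Rmult_0_r, !Rmult_0_l; field; lra.
Qed.

Lemma jacobi_comb_pos (a mu s : R) : 0 < a -> 0 < s ->
  jacobi_comb a mu s = jacobi_v a s * (mu + jacobi_ratio a s).
Proof.
intros Ha Hs; unfold jacobi_comb; rewrite jacobi_e_factor by lra; ring.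
Qed.

Lemma jacobi_comb_neg (a mu s : R) : 0 < a -> 0 < s ->
  jacobi_comb a mu (- s) = jacobi_v a s * (jacobi_ratio a s - mu).
Proof.
intros Ha Hs; unfold jacobi_comb; rewrite jacobi_e_opp, jacobi_v_opp, jacobi_e_factor by lra; ring.
Qed.

Lemma jacobi_v_incr (a s t : R) : 0 < a -> s < t -> jacobi_v a s < jacobi_v a t.
Proof.
intros Ha Hst.
apply (incr_function (jacobi_v a) m_infty p_infty
  (fun u => sinh a ^ 2 * cosh a * cosh u / sqrt (W a u) ^ 3));
  try exact I; try exact Hst.
- intros u _ _; assert (Hw := W_gt0 a u Ha); assert (Hy := sqrtW_gt0 a u Ha).
  unfold jacobi_v; auto_derive; [repeat split; lra|].
  assert (E := sqrtW_pow2 a u Ha).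
  assert (E' : W a u = cosh a ^ 2 * cosh u ^ 2 - 1) by reflexivity.
  assert (Ea : sinh a ^ 2 = cosh a ^ 2 - 1) by (rewrite cosh_pow2; ring).
  assert (Es : sinh u ^ 2 = cosh u ^ 2 - 1) by (rewrite cosh_pow2; ring).
  set (Y := sqrt (W a u)) in *.
  rewrite <- E in *; clear Hw; clearbody Y.
  field_simplify_eq; [|lra].
  ring [E' Ea Es].
- intros u _ _; apply Rdiv_lt_0_compat; [|apply pow_lt, sqrtW_gt0, Ha].
  apply Rmult_lt_0_compat; [apply Rmult_lt_0_compat | apply cosh_gt0].
  + apply pow_lt, sinh_gt0, Ha.
  + apply cosh_gt0.
Qed.

(** With the critical slope [E], the combination vanishes at [-l] and, from the
    positive side, at infinity. *)
Lemma jacobi_comb_gt0 (a E l s : R) : 0 < a -> is_sup_height_var a E ->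
  0 < l -> jacobi_ratio a l = E -> - l < s -> 0 < jacobi_comb a E s.
Proof.
intros Ha HE Hl Hq Hs; destruct (Rtotal_order s 0) as [h | [-> | h]].
- rewrite <- (Ropp_involutive s), jacobi_comb_neg by lra.
  apply Rmult_lt_0_compat; [apply jacobi_v_gt0; lra|].
  assert (H := jacobi_ratio_decr a (- s) l Ha); lra.
- rewrite jacobi_comb_0 by exact Ha; lra.
- rewrite jacobi_comb_pos by assumption.
  apply Rmult_lt_0_compat; [apply jacobi_v_gt0; lra|].
  assert (H := jacobi_ratio_gt_opp_sup a E s Ha HE h); lra.
Qed.

(** On each side the combination is [jacobi_v], of increasing absolute value,
    times a monotone factor that makes it negative at the end of the interval;
    on the positive side there is such an end because [mu < E]. *)
Lemma jacobi_comb_lt (a E mu l s1 : R) : 0 < a -> is_sup_height_var a E -> mu < E ->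
  0 < l < - s1 -> jacobi_ratio a l = mu ->
  exists s2 d, s1 < s2 /\ 0 < d /\
    forall s, s <= s1 \/ s2 <= s -> jacobi_comb a mu s <= - d.
Proof.
intros Ha HE Hmu [Hl Hls] Hq.
destruct (jacobi_ratio_large a E mu Ha HE Hmu) as [s2 [Hs2 Hq2]].
assert (H1 := jacobi_ratio_decr a l (- s1) Ha (conj Hl Hls)).
assert (V1 := jacobi_v_gt0 a (- s1) Ha ltac:(lra)).
assert (V2 := jacobi_v_gt0 a s2 Ha Hs2).
exists s2, (Rmin (jacobi_v a (- s1) * (mu - jacobi_ratio a (- s1)))
               (jacobi_v a s2 * - (mu + jacobi_ratio a s2))).
split; [lra | split].
- apply Rmin_glb_lt; apply Rmult_lt_0_compat; lra.
- intros s [Hs | Hs].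
  + apply Rle_trans with (- (jacobi_v a (- s1) * (mu - jacobi_ratio a (- s1))));
      [|apply Ropp_le_contravar, Rmin_l].
    rewrite <- (Ropp_involutive s) at 1; rewrite jacobi_comb_neg by lra.
    assert (V : jacobi_v a (- s1) <= jacobi_v a (- s)).
    { destruct Hs as [Hs | ->]; [left; apply jacobi_v_incr; lra | lra]. }
    assert (Q : jacobi_ratio a (- s) <= jacobi_ratio a (- s1)).
    { destruct Hs as [Hs | ->]; [left; apply jacobi_ratio_decr; lra | lra]. }
    nra.
  + apply Rle_trans with (- (jacobi_v a s2 * - (mu + jacobi_ratio a s2)));
      [|apply Ropp_le_contravar, Rmin_r].
    rewrite jacobi_comb_pos by lra.
    assert (V : jacobi_v a s2 <= jacobi_v a s).
    { destruct Hs as [Hs | <-]; [left; apply jacobi_v_incr; lra | lra]. }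
    assert (Q : jacobi_ratio a s <= jacobi_ratio a s2).
    { destruct Hs as [Hs | <-]; [left; apply jacobi_ratio_decr; lra | lra]. }
    nra.
Qed.

(** * Curvature of the ambient space *)

Lemma locally_disk_l (x y : R) : x ^ 2 + y ^ 2 < 1 ->
  locally x (fun u => u ^ 2 + y ^ 2 < 1).
Proof.
intros H; apply (open_comp (fun u => u ^ 2 + y ^ 2) (fun z => z < 1));
  [|apply open_lt | exact H].
intros u _; apply (ex_derive_continuous (fun u : R => u ^ 2 + y ^ 2) u).
auto_derive; trivial.
Qed.

Lemma locally_disk_r (x y : R) : x ^ 2 + y ^ 2 < 1 ->
  locally y (fun u => x ^ 2 + u ^ 2 < 1).
Proof.
intros H; apply (open_comp (fun u => x ^ 2 + u ^ 2) (fun z => z < 1));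
  [|apply open_lt | exact H].
intros u _; apply (ex_derive_continuous (fun u : R => x ^ 2 + u ^ 2) u).
auto_derive; trivial.
Qed.

Definition dgmet (l i j : axis) (x y : R) : R :=
  match i, j with
  | ax, ax | ay, ay =>
      match l with ax => x | ay => y | at_ => 0 end *
      16 / (1 - x ^ 2 - y ^ 2) ^ 3
  | _, _ => 0
  end.

Lemma pderiv_gmet (l i j : axis) (x y t : R) : x ^ 2 + y ^ 2 < 1 ->
  pderiv l (gmet i j) (x, y, t) = dgmet l i j x y.
Proof.
intros H.
destruct i, j, l; unfold pderiv, gmet, dgmet; try apply Derive_const;
  try (rewrite Derive_const; unfold Rdiv; ring);
  apply is_derive_unique; auto_derive; try lra; field; lra.
Qed.

Definition chris_disk (k i j : axis) (x y : R) : R :=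
  match k, i, j with
  | ax, ax, ax | ay, ax, ay | ay, ay, ax => 2 * x / (1 - x ^ 2 - y ^ 2)
  | ax, ay, ay => - 2 * x / (1 - x ^ 2 - y ^ 2)
  | ay, ay, ay | ax, ax, ay | ax, ay, ax => 2 * y / (1 - x ^ 2 - y ^ 2)
  | ay, ax, ax => - 2 * y / (1 - x ^ 2 - y ^ 2)
  | _, _, _ => 0
  end.

Lemma christoffelE (k i j : axis) (x y t : R) : x ^ 2 + y ^ 2 < 1 ->
  christoffel k i j (x, y, t) = chris_disk k i j x y.
Proof.
intros H; unfold christoffel, sum_axis.
rewrite !pderiv_gmet by exact H.
destruct k, i, j; unfold gmet_inv, dgmet, chris_disk; field; lra.
Qed.

Definition dchris_disk (m k i j : axis) (x y : R) : R :=
  match m with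
  | ax => Derive (fun u => chris_disk k i j u y) x
  | ay => Derive (fun u => chris_disk k i j x u) y
  | at_ => 0
  end.

Lemma pderiv_christoffel (m k i j : axis) (x y t : R) : x ^ 2 + y ^ 2 < 1 ->
  pderiv m (christoffel k i j) (x, y, t) = dchris_disk m k i j x y.
Proof.
intros H; destruct m; unfold pderiv, dchris_disk.
- apply Derive_ext_loc; apply (filter_imp (fun u => u ^ 2 + y ^ 2 < 1));
    [intros u Hu; apply christoffelE, Hu | apply locally_disk_l, H].
- apply Derive_ext_loc; apply (filter_imp (fun u => x ^ 2 + u ^ 2 < 1));
    [intros u Hu; apply christoffelE, Hu | apply locally_disk_r, H].
- rewrite (Derive_ext _ (fun _ => chris_disk k i j x y)); [apply Derive_const|].
  intros u; apply christoffelE, H.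
Qed.

Definition dchris_disk_val (m k i j : axis) (x y : R) : R :=
  let D := 1 - x ^ 2 - y ^ 2 in
  let dx := match m with
    | ax => 2 / D + 4 * x ^ 2 / D ^ 2 | ay => 4 * x * y / D ^ 2 | at_ => 0 end in
  let dy := match m with
    | ax => 4 * x * y / D ^ 2 | ay => 2 / D + 4 * y ^ 2 / D ^ 2 | at_ => 0 end in
  match k, i, j with
  | ax, ax, ax | ay, ax, ay | ay, ay, ax => dx
  | ax, ay, ay => - dx
  | ay, ay, ay | ax, ax, ay | ax, ay, ax => dy
  | ay, ax, ax => - dy
  | _, _, _ => 0
  end.

Lemma dchris_diskE (m k i j : axis) (x y : R) : x ^ 2 + y ^ 2 < 1 ->
  dchris_disk m k i j x y = dchris_disk_val m k i j x y.
Proof.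
intros H.
destruct m, k, i, j; unfold dchris_disk, dchris_disk_val, chris_disk; try apply Derive_const;
  try (ring); apply is_derive_unique; auto_derive; try lra; field; lra.
Qed.

Definition ricci_val (i j : axis) (x y : R) : R :=
  match i, j with
  | ax, ax | ay, ay => - (2 / (1 - x ^ 2 - y ^ 2)) ^ 2
  | _, _ => 0
  end.

(** The disk has curvature [-1], hence the Ricci tensor is minus its metric. *)
Lemma ricciE (i j : axis) (x y t : R) : x ^ 2 + y ^ 2 < 1 ->
  ricci i j (x, y, t) = ricci_val i j x y.
Proof.
intros H; unfold ricci, sum_axis.
rewrite !pderiv_christoffel, !dchris_diskE, !christoffelE by exact H.
destruct i, j; unfold dchris_disk_val, chris_disk, ricci_val; field; lra.
Qed.

(** * Geometry of the catenoid *)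

(** This is [tanh (radius a s / 2)], the Euclidean distance to the axis in the
    disk model. *)
Definition rho (a s : R) : R := sqrt (W a s) / (cosh a * cosh s + 1).

Lemma XE (a s th : R) : 0 < a ->
  X a s th = (rho a s * cos th, rho a s * sin th, Lambda a s).
Proof.
intros Ha; unfold X, radius; rewrite tanh_half_arcosh.
- unfold rho, W; rewrite Rpow_mult_distr; reflexivity.
- left; apply coshcosh_gt1, Ha.
Qed.

Definition drho (a s : R) : R :=
  cosh a * sinh s / (sqrt (W a s) * (cosh a * cosh s + 1)).

Lemma is_derive_rho (a s : R) : 0 < a -> is_derive (rho a) s (drho a s).
Proof.
intros Ha; assert (Hx := coshcosh_gt1 a s Ha); assert (Hy := sqrtW_gt0 a s Ha).
unfold rho; auto_derive; [split; [apply W_gt0, Ha | split; [lra | trivial]]|].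
unfold drho; assert (E := sqrtW_pow2 a s Ha).
assert (E' : W a s = cosh a ^ 2 * cosh s ^ 2 - 1) by reflexivity.
rewrite <- E in E'; set (Y := sqrt (W a s)) in *; clearbody Y.
field_simplify_eq; [|lra].
ring [E'].
Qed.

Lemma rho_pow2 (a s : R) : 0 < a ->
  1 - rho a s ^ 2 = 2 / (cosh a * cosh s + 1).
Proof.
intros Ha; assert (Hx := coshcosh_gt1 a s Ha).
unfold rho, Rdiv; rewrite Rpow_mult_distr, sqrtW_pow2 by exact Ha.
unfold W; field; lra.
Qed.

Lemma cos_sin_pow2 (th : R) : cos th ^ 2 + sin th ^ 2 = 1.
Proof. rewrite Rplus_comm, <- !Rsqr_pow2; apply sin2_cos2. Qed.

Lemma disk_polar (a s th : R) : 0 < a ->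
  1 - (rho a s * cos th) ^ 2 - (rho a s * sin th) ^ 2 =
  2 / (cosh a * cosh s + 1).
Proof.
intros Ha; rewrite <- rho_pow2 by exact Ha.
transitivity (1 - rho a s ^ 2 * (cos th ^ 2 + sin th ^ 2)); [ring|].
rewrite cos_sin_pow2; ring.
Qed.

Lemma disk_X (a s th : R) : 0 < a ->
  (rho a s * cos th) ^ 2 + (rho a s * sin th) ^ 2 < 1.
Proof.
intros Ha; assert (H := disk_polar a s th Ha).
assert (Hx := coshcosh_gt1 a s Ha).
assert (0 < 2 / (cosh a * cosh s + 1)) by (apply Rdiv_lt_0_compat; lra).
lra.
Qed.

Definition tangent_val (a : R) (b : param) (i : axis) (s th : R) : R :=
  match b, i with
  | ps, ax => drho a s * cos th
  | ps, ay => drho a s * sin th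
  | ps, at_ => sinh a / sqrt (W a s)
  | pth, ax => - rho a s * sin th
  | pth, ay => rho a s * cos th
  | pth, at_ => 0
  end.

Lemma tangentE (a : R) (b : param) (i : axis) : 0 < a ->
  tangent (X a) b i = tangent_val a b i.
Proof.
intros Ha; apply functional_extensionality; intros s.
apply functional_extensionality; intros th.
unfold tangent.
replace (fun u v => coord i (X a u v)) with
  (fun u v => coord i (rho a u * cos v, rho a u * sin v, Lambda a u)).
2:{ apply functional_extensionality; intros u.
    apply functional_extensionality; intros v; rewrite XE by exact Ha.
    reflexivity. }
assert (Hr := is_derive_rho a s Ha).
assert (Hr' : Derive (fun x => rho a x) s = drho a s)
  by apply is_derive_unique, Hr.
destruct b, i; unfold dparam, coord, tangent_val;
  try (apply is_derive_unique; auto_derive;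
       [try (eexists; exact Hr); trivial | rewrite ?Hr'; ring]).
apply is_derive_unique, is_derive_Lambda, Ha.
Qed.

Definition ddrho (a s : R) : R :=
  cosh a * (sinh a ^ 2 * cosh s / (sqrt (W a s) ^ 3 * (cosh a * cosh s + 1)) -
    cosh a * sinh s ^ 2 / (sqrt (W a s) * (cosh a * cosh s + 1) ^ 2)).

Lemma is_derive_drho (a s : R) : 0 < a -> is_derive (drho a) s (ddrho a s).
Proof.
intros Ha; assert (Hx := coshcosh_gt1 a s Ha); assert (Hy := sqrtW_gt0 a s Ha).
unfold drho; auto_derive.
{ split; [apply W_gt0, Ha | split; [|trivial]].
  apply Rgt_not_eq, Rmult_lt_0_compat; lra. }
unfold ddrho; assert (E := sqrtW_pow2 a s Ha).
assert (E' : W a s = cosh a ^ 2 * cosh s ^ 2 - 1) by reflexivity.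
assert (Ea : sinh a ^ 2 = cosh a ^ 2 - 1) by (rewrite cosh_pow2; ring).
assert (Es : sinh s ^ 2 = cosh s ^ 2 - 1) by (rewrite cosh_pow2; ring).
rewrite <- E in E'; set (Y := sqrt (W a s)) in *; clearbody Y.
field_simplify_eq; [|lra].
ring [E' Ea Es].
Qed.

Definition dtangent_val (a : R) (b c : param) (i : axis) (s th : R) : R :=
  match b, c, i with
  | ps, ps, ax => ddrho a s * cos th
  | ps, ps, ay => ddrho a s * sin th
  | ps, ps, at_ =>
      - sinh a * (cosh a ^ 2 * cosh s * sinh s) / sqrt (W a s) ^ 3
  | pth, pth, ax => - rho a s * cos th
  | pth, pth, ay => - rho a s * sin th
  | pth, pth, at_ => 0
  | _, _, ax => - drho a s * sin th
  | _, _, ay => drho a s * cos th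
  | _, _, at_ => 0
  end.

Lemma dparam_tangent_val (a : R) (b c : param) (i : axis) (s th : R) : 0 < a ->
  dparam b (tangent_val a c i) s th = dtangent_val a b c i s th.
Proof.
intros Ha; assert (Hy := sqrtW_gt0 a s Ha).
assert (Hr := is_derive_rho a s Ha).
assert (Hr' : Derive (fun x => rho a x) s = drho a s)
  by apply is_derive_unique, Hr.
assert (Hd := is_derive_drho a s Ha).
assert (Hd' : Derive (fun x => drho a x) s = ddrho a s)
  by apply is_derive_unique, Hd.
destruct b, c, i; unfold dparam, tangent_val, dtangent_val; try apply Derive_const;
  apply is_derive_unique; auto_derive;
  try (repeat split; first [exact I | apply W_gt0, Ha | lra |
    eexists; exact Hr | eexists; exact Hd]);
  rewrite ?Hr', ?Hd'; try ring.
field; lra.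
Qed.

(** * First fundamental form of the catenoid *)

(** The conformal factor [2 / (1 - x ^ 2 - y ^ 2)] of the disk metric, along the
    catenoid. *)
Definition conf_factor (a s : R) : R := cosh a * cosh s + 1.

Lemma conf_factor_gt0 (a s : R) : 0 < a -> 0 < conf_factor a s.
Proof. intros Ha; assert (H := coshcosh_gt1 a s Ha); unfold conf_factor; lra. Qed.

Lemma gmet_X (a s th : R) (i j : axis) : 0 < a ->
  gmet i j (X a s th) =
  match i, j with
  | ax, ax | ay, ay => conf_factor a s ^ 2 | at_, at_ => 1 | _, _ => 0
  end.
Proof.
intros Ha; assert (H := conf_factor_gt0 a s Ha); rewrite XE by exact Ha.
unfold gmet; rewrite disk_polar by exact Ha; fold (conf_factor a s).
destruct i, j; try reflexivity; field; lra.
Qed.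

Lemma gmet_inv_X (a s th : R) (i j : axis) : 0 < a ->
  gmet_inv i j (X a s th) =
  match i, j with
  | ax, ax | ay, ay => / conf_factor a s ^ 2 | at_, at_ => 1 | _, _ => 0
  end.
Proof.
intros Ha; assert (H := conf_factor_gt0 a s Ha); rewrite XE by exact Ha.
unfold gmet_inv; rewrite disk_polar by exact Ha; fold (conf_factor a s).
destruct i, j; try reflexivity; field; lra.
Qed.

Lemma conf_factor_rho (a s : R) : 0 < a -> conf_factor a s * rho a s = sqrt (W a s).
Proof.
intros Ha; assert (H := conf_factor_gt0 a s Ha); unfold rho; fold (conf_factor a s).
field; lra.
Qed.

Lemma conf_factor_drho (a s : R) : 0 < a -> conf_factor a s * drho a s = jacobi_v a s.
Proof.
intros Ha; assert (H := conf_factor_gt0 a s Ha); assert (Hy := sqrtW_gt0 a s Ha).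
unfold drho, jacobi_v; fold (conf_factor a s); field; lra.
Qed.

(** The derivative of [Lambda a] at [s], and up to sign the horizontal component
    of the unit normal. *)
Definition slope (a s : R) : R := sinh a / sqrt (W a s).

(** The profile curve is parametrized by arc length. *)
Lemma jacobi_v_slope (a s : R) : 0 < a -> jacobi_v a s ^ 2 + slope a s ^ 2 = 1.
Proof.
intros Ha; assert (Hy := sqrtW_gt0 a s Ha); unfold jacobi_v, slope.
apply (Rmult_eq_reg_r (sqrt (W a s) ^ 2)); [|apply Rgt_not_eq, pow_lt, Hy].
transitivity (cosh a ^ 2 * sinh s ^ 2 + sinh a ^ 2); [field; lra|].
rewrite sqrtW_pow2, W_split by exact Ha; ring.
Qed.

Lemma hmetE (a : R) (b c : param) (s th : R) : 0 < a ->
  hmet (X a) b c s th =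
  match b, c with ps, ps => 1 | pth, pth => W a s | _, _ => 0 end.
Proof.
intros Ha; unfold hmet, sum_axis.
rewrite !tangentE, !gmet_X by exact Ha; unfold tangent_val; fold (slope a s).
destruct b, c.
- transitivity ((conf_factor a s * drho a s) ^ 2 * (cos th ^ 2 + sin th ^ 2) +
    slope a s ^ 2); [ring|].
  rewrite cos_sin_pow2, conf_factor_drho, Rmult_1_r by exact Ha.
  apply jacobi_v_slope, Ha.
- ring.
- ring.
- transitivity ((conf_factor a s * rho a s) ^ 2 * (cos th ^ 2 + sin th ^ 2)); [ring|].
  rewrite cos_sin_pow2, conf_factor_rho, sqrtW_pow2 by exact Ha; ring.
Qed.

Lemma hdetE (a s th : R) : 0 < a -> hdet (X a) s th = W a s.
Proof. intros Ha; unfold hdet; rewrite !hmetE by exact Ha; ring. Qed.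

Lemma hmet_invE (a : R) (b c : param) (s th : R) : 0 < a ->
  hmet_inv (X a) b c s th =
  match b, c with ps, ps => 1 | pth, pth => / W a s | _, _ => 0 end.
Proof.
intros Ha; assert (H := W_gt0 a s Ha).
unfold hmet_inv; rewrite hdetE by exact Ha; destruct b, c;
  rewrite hmetE by exact Ha; field; lra.
Qed.

(** * Unit normal of the catenoid *)

Definition normal (a : R) (i : axis) (s th : R) : R :=
  match i with
  | ax => - slope a s * cos th / conf_factor a s
  | ay => - slope a s * sin th / conf_factor a s
  | at_ => jacobi_v a s
  end.

Lemma conormalE (a : R) (i : axis) (s th : R) : 0 < a ->
  conormal (X a) i s th =
  match i with
  | ax => - slope a s * rho a s * cos th
  | ay => - slope a s * rho a s * sin th
  | at_ => rho a s * drho a s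
  end.
Proof.
intros Ha; unfold conormal; rewrite !tangentE by exact Ha; unfold tangent_val.
fold (slope a s); destruct i; try ring.
transitivity (rho a s * drho a s * (cos th ^ 2 + sin th ^ 2)); [ring|].
rewrite cos_sin_pow2; ring.
Qed.

Lemma rho_gt0 (a s : R) : 0 < a -> 0 < rho a s.
Proof.
intros Ha; apply Rdiv_lt_0_compat; [apply sqrtW_gt0 | apply conf_factor_gt0]; exact Ha.
Qed.

Lemma unit_normalE (a : R) (i : axis) (s th : R) : 0 < a ->
  unit_normal (X a) i s th = normal a i s th.
Proof.
intros Ha; assert (Hl := conf_factor_gt0 a s Ha); assert (Hr := rho_gt0 a s Ha).
unfold unit_normal, sum_axis.
rewrite !gmet_inv_X, !conormalE by exact Ha.
replace (sqrt _) with (rho a s / conf_factor a s).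
- destruct i; unfold normal; try (field; lra).
  rewrite <- conf_factor_drho by exact Ha; field; lra.
- symmetry; rewrite <- (sqrt_pow2 (rho a s / conf_factor a s))
    by (left; apply Rdiv_lt_0_compat; assumption).
  f_equal.
  transitivity ((rho a s / conf_factor a s) ^ 2 * ((conf_factor a s * drho a s) ^ 2 +
    slope a s ^ 2 * (cos th ^ 2 + sin th ^ 2))); [field; lra|].
  rewrite cos_sin_pow2, conf_factor_drho, Rmult_1_r, jacobi_v_slope by exact Ha; ring.
Qed.

(** * Second fundamental form and Jacobi operator of the catenoid *)

(** The conformal factor times the Euclidean radius is [sqrt W], so that no
    denominator is left. *)
Lemma christoffel_X (a s th : R) (k i j : axis) : 0 < a ->
  christoffel k i j (X a s th) =
  sqrt (W a s) * match k, i, j with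
  | ax, ax, ax | ay, ax, ay | ay, ay, ax => cos th
  | ax, ay, ay => - cos th
  | ay, ay, ay | ax, ax, ay | ax, ay, ax => sin th
  | ay, ax, ax => - sin th
  | _, _, _ => 0
  end.
Proof.
intros Ha; assert (Hl := conf_factor_gt0 a s Ha).
rewrite XE, christoffelE by (try exact Ha; apply disk_X, Ha).
rewrite <- (conf_factor_rho a s) by exact Ha.
unfold chris_disk; rewrite disk_polar by exact Ha; fold (conf_factor a s).
destruct k, i, j; field; lra.
Qed.

Lemma cov_tangentE (a : R) (b c : param) (k : axis) (s th : R) : 0 < a ->
  cov_tangent (X a) b c k s th =
  match b, c, k with
  | ps, ps, ax => (ddrho a s + sqrt (W a s) * drho a s ^ 2) * cos th
  | ps, ps, ay => (ddrho a s + sqrt (W a s) * drho a s ^ 2) * sin th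
  | ps, ps, at_ =>
      - sinh a * (cosh a ^ 2 * cosh s * sinh s) / sqrt (W a s) ^ 3
  | pth, pth, ax => - (1 + sqrt (W a s) * rho a s) * rho a s * cos th
  | pth, pth, ay => - (1 + sqrt (W a s) * rho a s) * rho a s * sin th
  | pth, pth, at_ => 0
  | _, _, ax => - drho a s * (1 + sqrt (W a s) * rho a s) * sin th
  | _, _, ay => drho a s * (1 + sqrt (W a s) * rho a s) * cos th
  | _, _, at_ => 0
  end.
Proof.
intros Ha; assert (Hy := sqrtW_gt0 a s Ha).
unfold cov_tangent, sum_axis.
rewrite !tangentE, dparam_tangent_val, !christoffel_X by exact Ha.
assert (Et : sin th ^ 2 = 1 - cos th ^ 2) by (rewrite <- (cos_sin_pow2 th); ring).
destruct b, c, k; unfold dtangent_val, tangent_val; try ring [Et]; try (field; lra).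
Qed.

(** The principal curvatures are opposite, as the surface is minimal. The cross
    term vanishes by the symmetry with respect to planes through the axis. *)
Lemma second_formE (a : R) (b c : param) (s th : R) : 0 < a ->
  second_form (X a) b c s th =
  match b, c with
  | ps, ps => - (sinh a * (cosh a * cosh s)) / W a s
  | pth, pth => sinh a * (cosh a * cosh s)
  | _, _ => 0
  end.
Proof.
intros Ha; assert (Hy := sqrtW_gt0 a s Ha); assert (Hl := conf_factor_gt0 a s Ha).
unfold second_form, sum_axis.
rewrite !gmet_X, !cov_tangentE, !unit_normalE by exact Ha; unfold normal.
assert (E := sqrtW_pow2 a s Ha).
assert (E' : W a s = cosh a ^ 2 * cosh s ^ 2 - 1) by reflexivity.
assert (Ea : sinh a ^ 2 = cosh a ^ 2 - 1) by (rewrite cosh_pow2; ring).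
assert (Es : sinh s ^ 2 = cosh s ^ 2 - 1) by (rewrite cosh_pow2; ring).
destruct b, c.
- transitivity (- (conf_factor a s * slope a s) *
    (ddrho a s + sqrt (W a s) * drho a s ^ 2) * (cos th ^ 2 + sin th ^ 2) -
    sinh a * (cosh a ^ 2 * cosh s * sinh s) / sqrt (W a s) ^ 3 * jacobi_v a s);
    [field; lra|].
  rewrite cos_sin_pow2, Rmult_1_r; unfold conf_factor, slope, ddrho, drho, jacobi_v in *.
  set (Y := sqrt (W a s)) in *; rewrite <- E in *; clearbody Y.
  field_simplify_eq; [|lra].
  ring [E' Ea Es].
- field; lra.
- field; lra.
- transitivity ((conf_factor a s * rho a s) * (1 + sqrt (W a s) * rho a s) * slope a s *
    (cos th ^ 2 + sin th ^ 2)); [field; lra|].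
  rewrite cos_sin_pow2, conf_factor_rho by exact Ha; unfold slope, rho.
  fold (conf_factor a s).
  replace (cosh a * cosh s) with (conf_factor a s - 1) in * by (unfold conf_factor; ring).
  assert (E'' : sqrt (W a s) ^ 2 = conf_factor a s ^ 2 - 2 * conf_factor a s)
    by (rewrite E, E'; unfold conf_factor; ring).
  set (Y := sqrt (W a s)) in *; clearbody Y.
  field_simplify_eq; [|lra].
  ring [E''].
Qed.

Lemma second_form_norm2E (a s th : R) : 0 < a ->
  second_form_norm2 (X a) s th =
  2 * sinh a ^ 2 * cosh a ^ 2 * cosh s ^ 2 / W a s ^ 2.
Proof.
intros Ha; assert (H := W_gt0 a s Ha).
unfold second_form_norm2, sum_param.
rewrite !hmet_invE, !second_formE by exact Ha; field; lra.
Qed.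

Lemma ricci_normalE (a s th : R) : 0 < a ->
  ricci_normal (X a) s th = - sinh a ^ 2 / W a s.
Proof.
intros Ha; assert (Hl := conf_factor_gt0 a s Ha); assert (Hy := sqrtW_gt0 a s Ha).
unfold ricci_normal, sum_axis.
rewrite XE, !ricciE by (try exact Ha; apply disk_X, Ha).
rewrite !unit_normalE by exact Ha; unfold ricci_val, normal.
rewrite disk_polar by exact Ha; fold (conf_factor a s).
transitivity (- slope a s ^ 2 * (cos th ^ 2 + sin th ^ 2)); [field; lra|].
rewrite cos_sin_pow2; unfold slope.
rewrite <- (sqrtW_pow2 a s) at 2 by exact Ha; field; lra.
Qed.

Lemma potentialE (a s th : R) : 0 < a ->
  ricci_normal (X a) s th + second_form_norm2 (X a) s th = potential a s.
Proof.
intros Ha; assert (H := W_gt0 a s Ha).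
rewrite ricci_normalE, second_form_norm2E by exact Ha; unfold potential.
field_simplify_eq; [|lra]; unfold W; ring.
Qed.

Lemma jacobi_opE (a : R) (u : R -> R -> R) (s th : R) : 0 < a ->
  jacobi_op (X a) u s th * sqrt (W a s) =
  - Derive (fun s' => sqrt (W a s') * Derive (fun z => u z th) s') s -
  Derive (fun t => Derive (fun z => u s z) t) th / sqrt (W a s) -
  sqrt (W a s) * potential a s * u s th.
Proof.
intros Ha; assert (H := W_gt0 a s Ha); assert (Hy := sqrtW_gt0 a s Ha).
unfold jacobi_op; rewrite potentialE by exact Ha.
unfold laplacian, sum_param; rewrite hdetE by exact Ha; unfold dparam.
replace (fun u0 => sqrt (hdet (X a) u0 th) *
    (hmet_inv (X a) ps ps u0 th * Derive (fun u1 => u u1 th) u0 +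
     hmet_inv (X a) ps pth u0 th * Derive (fun u1 => u u0 u1) th))
  with (fun s' => sqrt (W a s') * Derive (fun z => u z th) s').
2:{ apply functional_extensionality; intros z.
    rewrite hdetE, !hmet_invE by exact Ha; ring. }
replace (fun u0 => sqrt (hdet (X a) s u0) *
    (hmet_inv (X a) pth ps s u0 * Derive (fun u1 => u u1 u0) s +
     hmet_inv (X a) pth pth s u0 * Derive (fun u1 => u s u1) u0))
  with (fun t => / sqrt (W a s) * Derive (fun z => u s z) t).
2:{ apply functional_extensionality; intros z.
    rewrite hdetE, !hmet_invE by exact Ha.
    replace (/ W a s) with (/ sqrt (W a s) ^ 2)
      by (rewrite sqrtW_pow2 by exact Ha; reflexivity).
    field; lra. }
rewrite Derive_scal.
change (fun t => Derive (fun z => u s z) t) with (Derive (fun z => u s z)).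
field; lra.
Qed.

(** * Integrals depending on a parameter *)

Lemma continuous_of_2d_r (F : R -> R -> R) (x t : R) :
  continuity_2d_pt F x t -> continuous (F x) t.
Proof.
intros H; apply continuity_pt_filterlim; intros eps Heps.
destruct (H (mkposreal eps Heps)) as [d Hd].
exists d; split; [apply cond_pos|]; intros y [_ Hy].
apply Hd; [rewrite Rminus_diag, Rabs_R0; apply cond_pos | exact Hy].
Qed.

Lemma ex_RInt_2d (F : R -> R -> R) (x b c : R) :
  (forall t, continuity_2d_pt F x t) -> ex_RInt (F x) b c.
Proof.
intros H; apply (ex_RInt_continuous (V := R_CompleteNormedModule)).
intros t _; apply continuous_of_2d_r, H.
Qed.

Lemma locally_interval (lo hi x : R) : lo < x < hi ->
  locally x (fun y => lo < y < hi).
Proof.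
intros H; apply (open_and (fun y => lo < y) (fun y => y < hi));
  [apply open_gt | apply open_lt | exact H].
Qed.

(** By uniform continuity of [F] on a compact rectangle. *)
Lemma continuous_RInt_2d (F : R -> R -> R) (lo hi x b c : R) :
  lo < x < hi -> b <= c ->
  (forall y t, lo < y < hi -> continuity_2d_pt F y t) ->
  continuous (fun y => RInt (F y) b c) x.
Proof.
intros Hx Hbc HF; apply continuity_pt_filterlim; intros eps Heps.
pose (x1 := (lo + x) / 2); pose (x2 := (x + hi) / 2).
assert (Heta : 0 < eps / (2 * (c - b + 1))) by (apply Rdiv_lt_0_compat; lra).
destruct (uniform_continuity_2d F x1 x2 b c) with
  (eps := mkposreal _ Heta) as [d Hd].
{ intros y t Hy _; apply HF; unfold x1, x2 in Hy; lra. }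
pose (r := Rmin d (Rmin (x - x1) (x2 - x))).
assert (Hr : 0 < r).
{ unfold r, x1, x2; repeat apply Rmin_glb_lt; [apply cond_pos | lra | lra]. }
exists r; split; [exact Hr|]; intros y [_ Hy].
simpl in *; unfold Rdist in *.
assert (Hyd : Rabs (y - x) < d) by (eapply Rlt_le_trans; [exact Hy | apply Rmin_l]).
assert (Hyx : Rabs (y - x) < Rmin (x - x1) (x2 - x))
  by (eapply Rlt_le_trans; [exact Hy | apply Rmin_r]).
assert (Hy1 : Rabs (y - x) < x - x1) by (eapply Rlt_le_trans; [exact Hyx | apply Rmin_l]).
assert (Hy2 : Rabs (y - x) < x2 - x) by (eapply Rlt_le_trans; [exact Hyx | apply Rmin_r]).
apply Rabs_def2 in Hy1; apply Rabs_def2 in Hy2.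
assert (I1 : ex_RInt (F y) b c).
{ apply ex_RInt_2d; intros t; apply HF; unfold x1, x2 in *; lra. }
assert (I2 : ex_RInt (F x) b c).
{ apply ex_RInt_2d; intros t; apply HF; unfold x1, x2 in *; lra. }
replace (RInt (F y) b c - RInt (F x) b c)
  with (RInt (fun t => minus (F y t) (F x t)) b c)
  by apply (RInt_minus (V := R_CompleteNormedModule) _ _ _ _ I1 I2).
apply Rle_lt_trans with ((c - b) * (eps / (2 * (c - b + 1)))).
- apply abs_RInt_le_const; [exact Hbc | apply (ex_RInt_minus (V := R_NormedModule)); assumption |].
  intros t Ht; left; apply (Hd x t y t); try (unfold x1, x2 in *; lra).
  rewrite Rminus_diag, Rabs_R0; apply cond_pos.
- replace ((c - b) * (eps / (2 * (c - b + 1)))) with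
    (eps * ((c - b) / (2 * (c - b + 1)))) by (field; lra).
  rewrite <- (Rmult_1_r eps) at 2; apply Rmult_lt_compat_l; [exact Heps|].
  apply Rlt_div_l; lra.
Qed.

Lemma is_derive_RInt_2d (F dF : R -> R -> R) (lo hi x b c : R) :
  lo < x < hi ->
  (forall y t, lo < y < hi -> is_derive (fun z => F z t) y (dF y t)) ->
  (forall y t, lo < y < hi -> continuity_2d_pt F y t) ->
  (forall y t, lo < y < hi -> continuity_2d_pt dF y t) ->
  is_derive (fun y => RInt (F y) b c) x (RInt (dF x) b c).
Proof.
intros Hx HD HF HdF; assert (Hloc := locally_interval lo hi x Hx).
rewrite (RInt_ext (dF x) (fun t => Derive (fun u => F u t) x)).
2:{ intros t _; symmetry; apply is_derive_unique, HD, Hx. }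
apply (is_derive_RInt_param F b c x).
- revert Hloc; apply filter_imp; intros y Hy t _; eexists; apply HD, Hy.
- intros t _; apply (continuity_2d_pt_ext_loc dF); [|apply HdF, Hx].
  destruct Hloc as [d Hd]; exists d; intros u v Hu _.
  symmetry; apply is_derive_unique, HD, Hd, Hu.
- revert Hloc; apply filter_imp; intros y Hy.
  apply ex_RInt_2d; intros t; apply HF, Hy.
Qed.

Lemma RInt_gen_compact (h : R -> R) (b c : R) : b < c ->
  ex_RInt h b c -> (forall s, s <= b \/ c <= s -> h s = 0) ->
  RInt_gen h (Rbar_locally m_infty) (Rbar_locally p_infty) = RInt h b c.
Proof.
intros Hbc Hex H0.
apply (is_RInt_gen_unique (V := R_CompleteNormedModule)).
intros P HP; exists (fun x => x < b) (fun y => c < y);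
  [exists b; auto | exists c; auto |].
intros x y Hx Hy; exists (RInt h b c); split; [|exact (locally_singleton _ _ HP)].
simpl.
assert (Z : forall u v, u <= v -> (v <= b \/ c <= u) -> is_RInt h u v 0).
{ intros u v Huv Hd.
  apply (is_RInt_ext (fun _ => 0)).
  - intros z Hz; rewrite Rmin_left, Rmax_right in Hz by exact Huv.
    symmetry; apply H0; lra.
  - assert (Hc := is_RInt_const (V := R_NormedModule) u v 0).
    replace (scal (v - u) (0 : R_NormedModule)) with 0 in Hc; [exact Hc|].
    symmetry; apply Rmult_0_r. }
replace (RInt h b c) with (plus 0 (plus (RInt h b c) 0))
  by (unfold plus; simpl; ring).
apply (is_RInt_Chasles (V := R_NormedModule)) with b; [apply Z; lra|].
apply (is_RInt_Chasles (V := R_NormedModule)) with c; [|apply Z; lra].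
apply (RInt_correct (V := R_CompleteNormedModule)), Hex.
Qed.

(** * Stability from a positive Jacobi field *)

Lemma ex_diff_n_unfold (u : R -> R -> R) (n : nat) (s t : R) :
  ex_diff_n u (S n) s t ->
  continuity_2d_pt u s t /\ ex_derive (fun z => u z t) s /\
  ex_derive (fun z => u s z) t /\
  ex_diff_n (fun x y => Derive (fun z => u z y) x) n s t /\
  ex_diff_n (fun x y => Derive (fun z => u x z) y) n s t.
Proof. intros H; exact H. Qed.

Lemma ex_diff_n_0 (u : R -> R -> R) (n : nat) (s t : R) :
  ex_diff_n u n s t -> continuity_2d_pt u s t.
Proof. destruct n; intros H; apply H. Qed.

(** The integrand of the stability form with the derivative of [sqrt W u_s]
    expanded, so that only derivatives of [u] itself occur. *)
Definition energy (a : R) (u : R -> R -> R) (s t : R) : R :=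
  - u s t * (cosh a ^ 2 * cosh s * sinh s / sqrt (W a s) *
      Derive (fun z => u z t) s +
    sqrt (W a s) * Derive (fun y => Derive (fun z => u z t) y) s) -
  u s t * Derive (fun y => Derive (fun z => u s z) y) t / sqrt (W a s) -
  sqrt (W a s) * potential a s * u s t ^ 2.

Lemma energyE (a : R) (u : R -> R -> R) (s t : R) : 0 < a ->
  (forall n s t, ex_diff_n u n s t) ->
  u s t * jacobi_op (X a) u s t * sqrt (hdet (X a) s t) = energy a u s t.
Proof.
intros Ha Hu; rewrite hdetE, Rmult_assoc, jacobi_opE by exact Ha.
destruct (ex_diff_n_unfold _ _ _ _ (Hu 2%nat s t)) as (_ & _ & _ & H1 & _).
destruct (ex_diff_n_unfold _ _ _ _ H1) as (_ & H2 & _).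
rewrite Derive_mult; [|eexists; apply is_derive_sqrtW, Ha | exact H2].
replace (Derive (fun x => sqrt (W a x)) s)
  with (cosh a ^ 2 * cosh s * sinh s / sqrt (W a s))
  by (symmetry; apply is_derive_unique, is_derive_sqrtW, Ha).
unfold energy, Rdiv.
change (fun y => Derive (fun z => u z t) y) with (Derive (fun z => u z t)).
ring.
Qed.

Ltac cont2d :=
  repeat first
    [ assumption
    | apply continuity_2d_pt_const
    | apply continuity_2d_pt_minus
    | apply continuity_2d_pt_plus
    | apply continuity_2d_pt_opp
    | apply continuity_2d_pt_mult ].

Lemma continuous_sqrtW (a s : R) : 0 < a -> continuous (fun u => sqrt (W a u)) s.
Proof.
intros Ha; apply (ex_derive_continuous (fun u : R => sqrt (W a u)) s).
eexists; apply is_derive_sqrtW, Ha.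
Qed.

Lemma continuous_potential (a s : R) : 0 < a -> continuous (potential a) s.
Proof.
intros Ha; apply (ex_derive_continuous (potential a) s); unfold potential.
auto_derive.
assert (H := W_gt0 a s Ha); apply Rgt_not_eq; nra.
Qed.

Lemma continuity_2d_energy (a : R) (u : R -> R -> R) (s t : R) : 0 < a ->
  (forall n s t, ex_diff_n u n s t) -> continuity_2d_pt (energy a u) s t.
Proof.
intros Ha Hu.
destruct (ex_diff_n_unfold _ _ _ _ (Hu 2%nat s t)) as (C0 & _ & _ & H1 & H2).
destruct (ex_diff_n_unfold _ _ _ _ H1) as (C1 & _ & _ & H3 & _).
destruct (ex_diff_n_unfold _ _ _ _ H2) as (C2 & _ & _ & _ & H4).
apply ex_diff_n_0 in H3; apply ex_diff_n_0 in H4.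
assert (CY : continuity_2d_pt (fun s _ => sqrt (W a s)) s t)
  by (apply (continuity_2d_of_continuous (fun s => sqrt (W a s))),
      continuous_sqrtW, Ha).
assert (CI : continuity_2d_pt (fun s _ => / sqrt (W a s)) s t)
  by (apply (continuity_2d_of_continuous (fun s => / sqrt (W a s))),
      continuous_inv_sqrtW, Ha).
assert (CQ : continuity_2d_pt (fun s _ => potential a s) s t)
  by (apply continuity_2d_of_continuous, continuous_potential, Ha).
assert (CC : continuity_2d_pt (fun s _ => cosh s) s t)
  by (apply continuity_2d_of_continuous, continuous_cosh).
assert (CS : continuity_2d_pt (fun s _ => sinh s) s t)
  by (apply continuity_2d_of_continuous, continuous_sinh).
unfold energy, Rdiv; simpl; cont2d.
Qed.

(** The flux in Picone's identity. If [w] solves the Jacobi equation,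
    [energy + dpicone] is [sqrt W (u_s - u w_s / w) ^ 2 - u u_tt / sqrt W], and
    the last term has the integral of [u_t ^ 2 / sqrt W] over a period. *)
Definition picone (a : R) (w dw : R -> R) (u : R -> R -> R) (s t : R) : R :=
  sqrt (W a s) * u s t * Derive (fun z => u z t) s -
  u s t ^ 2 * (sqrt (W a s) * dw s) / w s.

Definition dpicone (a : R) (w dw : R -> R) (u : R -> R -> R) (s t : R) : R :=
  sqrt (W a s) *
    (Derive (fun z => u z t) s - u s t * dw s / w s) ^ 2 +
  u s t * (cosh a ^ 2 * cosh s * sinh s / sqrt (W a s) *
      Derive (fun z => u z t) s +
    sqrt (W a s) * Derive (fun y => Derive (fun z => u z t) y) s) +
  sqrt (W a s) * potential a s * u s t ^ 2.

Lemma is_derive_picone (a : R) (w dw : R -> R) (u : R -> R -> R) (s t : R) :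
  0 < a -> (forall n s t, ex_diff_n u n s t) ->
  is_derive w s (dw s) ->
  is_derive (fun y => sqrt (W a y) * dw y) s
    (- sqrt (W a s) * potential a s * w s) ->
  w s <> 0 ->
  is_derive (fun y => picone a w dw u y t) s (dpicone a w dw u s t).
Proof.
intros Ha Hu Hw Hdw Hw0.
destruct (ex_diff_n_unfold _ _ _ _ (Hu 2%nat s t)) as (_ & D0 & _ & H1 & _).
destruct (ex_diff_n_unfold _ _ _ _ H1) as (_ & D1 & _).
assert (HY := is_derive_sqrtW a s Ha); assert (Hy := sqrtW_gt0 a s Ha).
unfold picone.
pose (f := fun y => sqrt (W a y) * dw y).
apply (is_derive_ext (fun y => sqrt (W a y) * u y t * Derive (fun z => u z t) y -
  u y t ^ 2 * f y / w y)); [reflexivity|].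
pose (g := fun y => sqrt (W a y)).
apply (is_derive_ext (fun y => g y * u y t * Derive (fun z => u z t) y -
  u y t ^ 2 * f y / w y)); [reflexivity|].
pose (u0 := fun y => u y t); pose (u1 := fun y => Derive (fun z => u z t) y).
apply (is_derive_ext (fun y => g y * u0 y * u1 y - u0 y ^ 2 * f y / w y));
  [reflexivity|].
fold f in Hdw; fold g in HY.
change (ex_derive u0 s) in D0; change (ex_derive u1 s) in D1.
auto_derive.
- repeat split; try assumption; eexists; eassumption.
- replace (Derive (fun x => g x) s)
    with (cosh a ^ 2 * cosh s * sinh s / sqrt (W a s))
    by (symmetry; apply is_derive_unique, HY).
  replace (Derive (fun x => f x) s) with (- sqrt (W a s) * potential a s * w s)
    by (symmetry; apply is_derive_unique, Hdw).
  replace (Derive (fun x => w x) s) with (dw s)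
    by (symmetry; apply is_derive_unique, Hw).
  change (Derive (fun x => u0 x) s) with (u1 s).
  unfold dpicone; fold (u1 s).
  change (Derive (fun y => Derive (fun z => u z t) y) s) with (Derive u1 s).
  change (Derive (fun x => u1 x) s) with (Derive u1 s).
  change (u s t) with (u0 s); unfold f, g.
  field; lra.
Qed.

Lemma RInt_zero (h : R -> R) (b c : R) : b <= c ->
  (forall t, b < t < c -> h t = 0) -> RInt h b c = 0.
Proof.
intros Hbc H; rewrite (RInt_ext _ (fun _ => 0)).
- rewrite (RInt_const (V := R_CompleteNormedModule)); apply Rmult_0_r.
- intros t Ht; rewrite Rmin_left, Rmax_right in Ht by lra; apply H, Ht.
Qed.

Lemma open_above (b : R) : open (fun p : point => b < snd p).
Proof.
apply (open_comp (fun p : point => snd p) (fun z => b < z)); [|apply open_gt].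
intros [q t] _; apply (continuous_snd q t).
Qed.

Lemma open_below (b : R) : open (fun p : point => snd p < b).
Proof.
apply (open_comp (fun p : point => snd p) (fun z => z < b)); [|apply open_lt].
intros [q t] _; apply (continuous_snd q t).
Qed.

(** Covers bounded and unbounded intervals at once, with exactly the two
    properties needed to enlarge a compact subinterval and to stay inside. *)
Definition is_open_interval (I : R -> Prop) : Prop :=
  (exists s, I s) /\
  (forall s, I s -> exists b c, I b /\ I c /\ b < s < c) /\
  (forall b c s, I b -> I c -> b <= s <= c -> I s).

(** The slabs between two heights [Lambda a b] and [Lambda a c] with [b], [c] in
    the interval are open and cover [K], because the height increases with [s];
    a finite subcover is contained in one slab. *)
Lemma compact_set_bounds (a : R) (I : R -> Prop) (K : point -> Prop) :
  0 < a -> is_open_interval I -> compact_set K ->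
  (forall p, K p -> X_image a I p) ->
  exists b c, I b /\ I c /\ b < c /\
    forall p, K p -> Lambda a b < snd p < Lambda a c.
Proof.
intros Ha [[s0 Hs0] [Hopen Hconv]] HK HKI.
pose (J := {bc : R * R | I (fst bc) /\ I (snd bc)}).
destruct (HK J (fun j p => Lambda a (fst (proj1_sig j)) < snd p /\
    snd p < Lambda a (snd (proj1_sig j)))) as [l Hl].
- intros j; apply (open_and (fun p : point => Lambda a (fst (proj1_sig j)) < snd p)
    (fun p : point => snd p < Lambda a (snd (proj1_sig j))));
    [apply open_above | apply open_below].
- intros p Hp; destruct (HKI p Hp) as [s [th [Hs [_ ->]]]].
  destruct (Hopen s Hs) as [b [c [Hb [Hc Hbc]]]].
  exists (exist _ (b, c) (conj Hb Hc)); simpl.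
  split; apply Lambda_incr; tauto.
- assert (Hl' : exists b c, I b /\ I c /\ b < c /\ forall j, In j l ->
    b <= fst (proj1_sig j) /\ snd (proj1_sig j) <= c).
  { clear Hl; induction l as [|[[b' c'] [Hb' Hc']] l IH].
    - destruct (Hopen s0 Hs0) as [b [c [Hb [Hc Hbc]]]].
      exists b, c; repeat split; try assumption; try lra; destruct H.
    - destruct IH as [b [c [Hb [Hc [Hbc H]]]]]; simpl in *.
      exists (Rmin b b'), (Rmax c c').
      assert (H1 := Rmin_l b b'); assert (H2 := Rmin_r b b').
      assert (H3 := Rmax_l c c'); assert (H4 := Rmax_r c c').
      split; [unfold Rmin; destruct (Rle_dec b b'); assumption|].
      split; [unfold Rmax; destruct (Rle_dec c c'); assumption|].
      split; [lra|].
      intros j [<- | Hj]; simpl; [lra|].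
      apply H in Hj; lra. }
  destruct Hl' as [b [c [Hb [Hc [Hbc H]]]]].
  exists b, c; repeat split; try assumption;
    destruct (Hl p H0) as [j [Hj [H1 H2]]]; apply H in Hj as [H3 H4].
  + destruct H3 as [H3 | ->]; [|exact H1].
    apply (Lambda_incr a) in H3; [lra | exact Ha].
  + destruct H4 as [H4 | <-]; [|exact H2].
    apply (Lambda_incr a) in H4; [lra | exact Ha].
Qed.

Lemma snd_X (a s th : R) : snd (X a s th) = Lambda a s.
Proof. reflexivity. Qed.

Lemma catenoid_X (a s th : R) : 0 <= th <= 2 * PI -> catenoid a (X a s th).
Proof. intros H; exists s, th; auto. Qed.

Lemma X_periodic (a s th : R) : X a s (th + 2 * PI) = X a s th.
Proof.
unfold X; rewrite cos_plus, sin_plus, cos_2PI, sin_2PI.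
f_equal; f_equal; ring.
Qed.

Lemma Derive_periodic (g : R -> R) (p x : R) : (forall y, g (y + p) = g y) ->
  ex_derive g (x + p) -> Derive g (x + p) = Derive g x.
Proof.
intros Hg [l Hl]; rewrite (is_derive_unique _ _ _ Hl).
symmetry; apply is_derive_unique, (is_derive_ext (fun y => g (y + p)));
  [exact Hg|].
replace l with (scal 1 l) by apply Rmult_1_l.
apply (is_derive_comp g (fun y => y + p)); [exact Hl|].
auto_derive; [trivial | ring].
Qed.

(** Integrating Picone's identity: the flux vanishes at both ends of the support
    of [u], and [u u_tt + u_t ^ 2] integrates to [0] over a period, so that only
    squares remain. *)
Lemma weakly_stable_of_positive_solution (a : R) (I : R -> Prop)
    (w dw : R -> R) :
  0 < a -> is_open_interval I ->
  (forall s, I s -> is_derive w s (dw s)) ->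
  (forall s, I s -> is_derive (fun y => sqrt (W a y) * dw y) s
    (- sqrt (W a s) * potential a s * w s)) ->
  (forall s, I s -> 0 < w s) ->
  weakly_stable a (X_image a I).
Proof.
intros Ha HI Hw Hdw Hpos f Hsm [K [HK [HKD HK0]]].
destruct (compact_set_bounds a I K Ha HI HK HKD) as [b [c [Hb [Hc [Hbc Hheight]]]]].
set (u := pullback a f) in *.
assert (Hu0 : forall s t, s <= b \/ c <= s -> 0 <= t <= 2 * PI -> u s t = 0).
{ intros s t Hs Ht; apply HK0; [apply catenoid_X, Ht|].
  intros HX; apply Hheight in HX; rewrite snd_X in HX.
  destruct HX as [HX1 HX2]; apply Lambda_lt_inv in HX1; [|exact Ha].
  apply Lambda_lt_inv in HX2; [lra | exact Ha]. }
assert (H2PI : 0 < 2 * PI) by (assert (H := PI_RGT_0); lra).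
assert (Hen : forall s t,
  u s t * jacobi_op (X a) u s t * sqrt (hdet (X a) s t) = energy a u s t)
  by (intros s t; apply energyE; assumption).
assert (Hcont : forall s t, continuity_2d_pt (energy a u) s t)
  by (intros s t; apply continuity_2d_energy; assumption).
unfold surface_integral.
rewrite (RInt_gen_compact _ b c Hbc).
2:{ apply (ex_RInt_continuous (V := R_CompleteNormedModule)); intros s _.
    apply (continuous_ext (fun s => RInt (energy a u s) 0 (2 * PI))).
    - intros y; apply RInt_ext; intros t _; symmetry; apply Hen.
    - apply (continuous_RInt_2d _ (s - 1) (s + 1)); [lra | lra | auto]. }
2:{ intros s Hs; apply RInt_zero; [lra|]; intros t Ht.
    rewrite Hu0 by (try exact Hs; lra); ring. }
rewrite (RInt_ext _ (fun s => RInt (energy a u s) 0 (2 * PI)))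
  by (intros s _; apply RInt_ext; intros t _; apply Hen).
destruct HI as [_ [Hopen Hconv]].
destruct (Hopen b Hb) as [b' [_ [Hb' [_ [Hbb _]]]]].
destruct (Hopen c Hc) as [_ [c' [_ [Hc' [_ Hcc]]]]].
assert (HIn : forall s, b' < s < c' -> I s)
  by (intros s Hs; apply (Hconv b' c'); [exact Hb' | exact Hc' | lra]).
assert (CU : forall s t, continuity_2d_pt u s t)
  by (intros s t; apply (Hsm 0%nat)).
assert (CU1 : forall s t, continuity_2d_pt (fun x y => Derive (fun z => u z y) x) s t).
{ intros s t; destruct (ex_diff_n_unfold _ _ _ _ (Hsm 1%nat s t))
    as (_ & _ & _ & H1 & _); apply ex_diff_n_0 in H1; exact H1. }
assert (CU2 : forall s t, continuity_2d_pt
  (fun x y => Derive (fun y0 => Derive (fun z => u z y) y0) x) s t).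
{ intros s t; destruct (ex_diff_n_unfold _ _ _ _ (Hsm 2%nat s t))
    as (_ & _ & _ & H1 & _).
  destruct (ex_diff_n_unfold _ _ _ _ H1) as (_ & _ & _ & H2 & _).
  apply ex_diff_n_0 in H2; exact H2. }
assert (CW : forall s t, b' < s < c' -> continuity_2d_pt (fun s _ => w s) s t).
{ intros s t Hs; apply continuity_2d_of_continuous,
    (ex_derive_continuous w s); eexists; apply Hw, HIn, Hs. }
assert (CWI : forall s t, b' < s < c' -> continuity_2d_pt (fun s _ => / w s) s t).
{ intros s t Hs; apply (continuity_2d_pt_inv (fun s _ => w s)); [auto|].
  apply Rgt_not_eq, Hpos, HIn, Hs. }
assert (CY : forall s t, continuity_2d_pt (fun s _ => sqrt (W a s)) s t).
{ intros s t; apply (continuity_2d_of_continuous (fun s => sqrt (W a s))),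
    continuous_sqrtW, Ha. }
assert (CYI : forall s t, continuity_2d_pt (fun s _ => / sqrt (W a s)) s t).
{ intros s t; apply (continuity_2d_of_continuous (fun s => / sqrt (W a s))),
    continuous_inv_sqrtW, Ha. }
assert (CF : forall s t, b' < s < c' ->
  continuity_2d_pt (fun s _ => sqrt (W a s) * dw s) s t).
{ intros s t Hs; apply (continuity_2d_of_continuous (fun s => sqrt (W a s) * dw s)),
    (ex_derive_continuous (fun s => sqrt (W a s) * dw s) s).
  eexists; apply Hdw, HIn, Hs. }
assert (CP : forall s t, b' < s < c' -> continuity_2d_pt (picone a w dw u) s t).
{ intros s t Hs; unfold picone, Rdiv; simpl.
  assert (H1 := CF s t Hs); assert (H2 := CWI s t Hs).
  specialize (CU s t); specialize (CU1 s t); specialize (CY s t).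
  cont2d. }
assert (CD : forall s t, b' < s < c' -> continuity_2d_pt (dpicone a w dw u) s t).
{ intros s t Hs; apply (continuity_2d_pt_ext (fun s t =>
    sqrt (W a s) * (Derive (fun z => u z t) s -
      u s t * (/ sqrt (W a s) * (sqrt (W a s) * dw s)) * / w s) ^ 2 +
    u s t * (cosh a ^ 2 * cosh s * sinh s * / sqrt (W a s) *
      Derive (fun z => u z t) s +
      sqrt (W a s) * Derive (fun y => Derive (fun z => u z t) y) s) +
    sqrt (W a s) * potential a s * u s t ^ 2)).
  - intros x y; unfold dpicone, Rdiv; assert (Hy := sqrtW_gt0 a x Ha).
    rewrite <- (Rmult_assoc (/ sqrt (W a x))), Rinv_l, Rmult_1_l by lra.
    reflexivity.
  - assert (CQ : continuity_2d_pt (fun s _ => potential a s) s t)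
      by (apply continuity_2d_of_continuous, continuous_potential, Ha).
    assert (CC : continuity_2d_pt (fun s _ => cosh s) s t)
      by (apply continuity_2d_of_continuous, continuous_cosh).
    assert (CS : continuity_2d_pt (fun s _ => sinh s) s t)
      by (apply continuity_2d_of_continuous, continuous_sinh).
    assert (H1 := CF s t Hs); assert (H2 := CWI s t Hs).
    specialize (CU s t); specialize (CU1 s t); specialize (CU2 s t).
    specialize (CY s t); specialize (CYI s t).
    simpl; cont2d. }
pose (G := fun s => RInt (picone a w dw u s) 0 (2 * PI)).
pose (dG := fun s => RInt (dpicone a w dw u s) 0 (2 * PI)).
assert (HG : forall s, b <= s <= c -> is_derive G s (dG s)).
{ intros s Hs; apply (is_derive_RInt_2d _ _ b' c'); [lra | | exact CP | exact CD].
  intros y t Hy; apply is_derive_picone; try assumption; auto.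
  apply Rgt_not_eq, Hpos, HIn, Hy. }
assert (HdG : forall s, b <= s <= c -> continuous dG s).
{ intros s Hs; apply (continuous_RInt_2d _ b' c'); [lra | lra | exact CD]. }
assert (HGI : is_RInt dG b c (G c - G b)).
{ apply (is_RInt_derive G dG); rewrite Rmin_left, Rmax_right by lra; assumption. }
assert (HG0 : forall s, s <= b \/ c <= s -> G s = 0).
{ intros s Hs; apply RInt_zero; [lra|]; intros t Ht.
  unfold picone; rewrite Hu0 by (try exact Hs; lra); unfold Rdiv; ring. }
rewrite !HG0, Rminus_diag in HGI by lra.
apply (is_RInt_opp (V := R_NormedModule)) in HGI.
apply Rle_trans with (RInt (fun s => - dG s) b c).
{ right; symmetry; etransitivity; [apply (is_RInt_unique _ _ _ _ HGI) | apply Ropp_0]. }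
apply RInt_le; [lra | eexists; exact HGI | |].
{ apply (ex_RInt_continuous (V := R_CompleteNormedModule)); intros s _.
  apply (continuous_RInt_2d _ (s - 1) (s + 1)); [lra | lra | auto]. }
intros s Hs.
(* What remains is an exact derivative in the angle, and a square. *)
pose (ut := fun t => Derive (fun z => u s z) t).
pose (h := fun t => ut t ^ 2 + u s t * Derive ut t).
assert (Hh : forall t, is_derive (fun t => u s t * ut t) t (h t)).
{ intros t; destruct (ex_diff_n_unfold _ _ _ _ (Hsm 2%nat s t))
    as (_ & _ & D0 & _ & H2).
  destruct (ex_diff_n_unfold _ _ _ _ H2) as (_ & _ & D1 & _).
  change (ex_derive (u s) t) in D0; change (ex_derive ut t) in D1.
  auto_derive; [repeat split; assumption|].
  change (Derive (fun x => u s x) t) with (ut t).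
  change (Derive (fun x => ut x) t) with (Derive ut t).
  unfold h; ring. }
assert (Ch : forall t, continuous h t).
{ intros t; destruct (ex_diff_n_unfold _ _ _ _ (Hsm 2%nat s t))
    as (H0 & _ & _ & _ & H2).
  destruct (ex_diff_n_unfold _ _ _ _ H2) as (H1 & _ & _ & _ & H3).
  apply ex_diff_n_0 in H3.
  apply (continuous_of_2d_r (fun s t => Derive (fun z => u s z) t ^ 2 +
    u s t * Derive (fun y => Derive (fun z => u s z) y) t) s t); simpl; cont2d. }
assert (Ih : is_RInt h 0 (2 * PI) 0).
{ replace 0 with (minus (u s (2 * PI) * ut (2 * PI)) (u s 0 * ut 0)) at 2.
  - apply (is_RInt_derive (fun t => u s t * ut t) h); auto.
  - rewrite <- (Rplus_0_l (2 * PI)).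
    assert (Hper : forall y, u s (y + 2 * PI) = u s y)
      by (intros y; unfold u, pullback; rewrite X_periodic; reflexivity).
    unfold ut at 1; rewrite (Derive_periodic (fun z => u s z)), Hper.
    + apply (minus_eq_zero (G := R_AbelianGroup)).
    + exact Hper.
    + apply (ex_diff_n_unfold _ _ _ _ (Hsm 2%nat s (0 + 2 * PI))). }
assert (Id : ex_RInt (dpicone a w dw u s) 0 (2 * PI))
  by (apply ex_RInt_2d; intros t; apply CD; lra).
apply (is_RInt_scal (V := R_NormedModule) _ _ _ (/ sqrt (W a s))) in Ih.
apply (is_RInt_plus (V := R_NormedModule) (dpicone a w dw u s) _ _ _ _ _
  (RInt_correct (V := R_CompleteNormedModule) _ _ _ Id)) in Ih.
apply (is_RInt_opp (V := R_NormedModule)) in Ih.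
apply Rle_trans with (RInt (fun t => - (dpicone a w dw u s t +
  / sqrt (W a s) * h t)) 0 (2 * PI)).
{ right; symmetry; etransitivity; [apply (is_RInt_unique _ _ _ _ Ih)|].
  unfold dG, plus, opp, scal; simpl; unfold mult; simpl; ring. }
apply RInt_le; [lra | eexists; exact Ih | |].
{ apply ex_RInt_2d; auto. }
intros t _.
assert (Hy := sqrtW_gt0 a s Ha).
assert (Hsq : 0 <= sqrt (W a s) *
  (Derive (fun z => u z t) s - u s t * dw s / w s) ^ 2)
  by (apply Rmult_le_pos; [lra | apply pow2_ge_0]).
assert (Hsq' : 0 <= / sqrt (W a s) * ut t ^ 2)
  by (apply Rmult_le_pos; [left; apply Rinv_0_lt_compat, Hy | apply pow2_ge_0]).
unfold dpicone, energy, h, Rdiv in *.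
change (Derive (fun y => Derive (fun z => u s z) y) t) with (Derive ut t).
lra.
Qed.

(** * Topology of the catenoid *)

Lemma continuous_pair {T U V : UniformSpace} (f : T -> U) (g : T -> V) (x : T) :
  continuous f x -> continuous g x -> continuous (fun t => (f t, g t)) x.
Proof.
intros Hf Hg; apply filterlim_locally; intros eps.
assert (H1 := proj1 (filterlim_locally _ _) Hf eps).
assert (H2 := proj1 (filterlim_locally _ _) Hg eps).
apply (filter_and _ _ H1) in H2; revert H2; apply filter_imp.
intros t [H3 H4]; split; assumption.
Qed.

Lemma continuous_ex_derive (f : R -> R) (x : R) : ex_derive f x -> continuous f x.
Proof. apply (ex_derive_continuous f x). Qed.

Lemma continuous_X {T : UniformSpace} (a : R) (s th : T -> R) (x : T) : 0 < a ->
  continuous s x -> continuous th x -> continuous (fun y => X a (s y) (th y)) x.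
Proof.
intros Ha Hs Hth.
apply (continuous_ext (fun y => (rho a (s y) * cos (th y),
  rho a (s y) * sin (th y), Lambda a (s y)))).
{ intros y; symmetry; apply XE, Ha. }
assert (Hr : continuous (fun y => rho a (s y)) x).
{ apply (continuous_comp s (rho a)); [exact Hs|].
  apply continuous_ex_derive; eexists; apply is_derive_rho, Ha. }
apply continuous_pair; [apply continuous_pair|].
- apply (continuous_mult (K := R_AbsRing)); [exact Hr|].
  apply (continuous_comp th cos); [exact Hth | apply continuous_cos].
- apply (continuous_mult (K := R_AbsRing)); [exact Hr|].
  apply (continuous_comp th sin); [exact Hth | apply continuous_sin].
- apply (continuous_comp s (Lambda a)); [exact Hs|].
  apply continuous_ex_derive; eexists; apply is_derive_Lambda, Ha.
Qed.

Lemma angle_repr (x : R) :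
  exists th, 0 <= th <= 2 * PI /\ cos th = cos x /\ sin th = sin x.
Proof.
assert (Hc := COS_bound x); assert (HP := acos_bound (cos x)).
assert (Hca : cos (acos (cos x)) = cos x) by (apply cos_acos; lra).
assert (E := sin2_cos2 (acos (cos x))); assert (E' := sin2_cos2 x).
rewrite Hca in E; unfold Rsqr in E, E'.
assert (Hs : 0 <= sin (acos (cos x))) by (apply sin_ge_0; lra).
destruct (Rle_lt_dec 0 (sin x)) as [h | h].
- exists (acos (cos x)); repeat split; try lra; nra.
- exists (- acos (cos x) + 2 * PI); repeat split; try lra.
  + rewrite cos_plus, cos_2PI, sin_2PI, cos_neg, Hca; ring.
  + rewrite sin_plus, cos_2PI, sin_2PI, sin_neg.
    assert (- sin (acos (cos x)) = sin x) by nra.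
    lra.
Qed.

Lemma rotate_X (a phi s th : R) : rotate phi (X a s th) = X a s (th + phi).
Proof.
unfold rotate, X; rewrite cos_plus, sin_plus; f_equal; f_equal; ring.
Qed.

Lemma X_image_X (a : R) (I : R -> Prop) (s th : R) : I s -> X_image a I (X a s th).
Proof.
intros Hs; destruct (angle_repr th) as [th' [H [Hc Hsn]]].
exists s, th'; split; [exact Hs | split; [exact H|]].
unfold X; rewrite Hc, Hsn; reflexivity.
Qed.

Lemma X_image_inv (a : R) (I : R -> Prop) (s th : R) : 0 < a ->
  X_image a I (X a s th) -> I s.
Proof.
intros Ha [s' [th' [Hs [_ E]]]].
apply (f_equal snd) in E; rewrite !snd_X in E.
apply Lambda_inj in E; [subst; exact Hs | exact Ha].
Qed.

Lemma rotation_invariant_X_image (a : R) (I : R -> Prop) :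
  rotation_invariant (X_image a I).
Proof.
intros phi p [s [th [Hs [_ ->]]]]; rewrite rotate_X; apply X_image_X, Hs.
Qed.

(** Join a point of [U] to a point of [V] by a path in the domain. The function
    equal to [1] where the path is in [U] and to [-1] elsewhere would be
    continuous, against the intermediate value theorem. *)
Lemma connected_X_image (a : R) (I : R -> Prop) : 0 < a ->
  (forall b c s, I b -> I c -> b <= s <= c -> I s) ->
  connected_set (X_image a I).
Proof.
intros Ha Hconv U V HU HV Hcov Hdisj [p [Dp Up]] [q [Dq Vq]].
destruct Dp as [s1 [t1 [I1 [_ Ep]]]]; destruct Dq as [s2 [t2 [I2 [_ Eq]]]].
(* The path is extended to the whole line, constantly outside [[0, 1]]. *)
pose (clamp := fun x : R => Rmax 0 (Rmin 1 x)).
assert (Hclamp : forall x, 0 <= clamp x <= 1).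
{ intros x; unfold clamp; split; [apply Rmax_l|].
  apply Rmax_lub; [lra | apply Rmin_l]. }
assert (Cclamp : forall x, continuous clamp x).
{ intros x; apply filterlim_locally; intros eps.
  exists eps; intros y Hy.
  unfold ball in *; simpl in *; unfold AbsRing_ball, abs, minus, plus, opp in *.
  simpl in *; unfold clamp.
  apply Rle_lt_trans with (2 := Hy).
  unfold Rmax, Rmin; repeat destruct Rle_dec; unfold Rabs;
    repeat destruct Rcase_abs; lra. }
pose (path := fun x => X a (s1 + clamp x * (s2 - s1)) (t1 + clamp x * (t2 - t1))).
assert (Cpath : forall x, continuous path x).
{ intros x; apply continuous_X; [exact Ha | |];
    apply (continuous_plus (V := R_NormedModule)); try apply continuous_const;
    apply (continuous_mult (K := R_AbsRing)); try apply continuous_const;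
    apply Cclamp. }
assert (Dpath : forall x, X_image a I (path x)).
{ intros x; apply X_image_X; specialize (Hclamp x).
  destruct (Rle_lt_dec s1 s2) as [h | h].
  - apply (Hconv s1 s2); [exact I1 | exact I2 | nra].
  - apply (Hconv s2 s1); [exact I2 | exact I1 | nra]. }
pose (chi := fun x => if excluded_middle_informative (U (path x)) then 1 else -1).
assert (Cchi : continuity chi).
{ intros x; apply continuity_pt_filterlim.
  destruct (Hcov (path x) (Dpath x)) as [Hx | Hx].
  - apply (continuous_ext_loc _ (fun _ => 1)); [|apply continuous_const].
    assert (L : locally x (fun y => U (path y))) by exact (Cpath x U (HU _ Hx)).
    revert L; apply filter_imp; intros y Hy.
    unfold chi; destruct excluded_middle_informative; [reflexivity | contradiction].
  - apply (continuous_ext_loc _ (fun _ => -1)); [|apply continuous_const].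
    assert (L : locally x (fun y => V (path y))) by exact (Cpath x V (HV _ Hx)).
    revert L; apply filter_imp; intros y Hy.
    unfold chi; destruct excluded_middle_informative as [h|]; [|reflexivity].
    exfalso; apply (Hdisj (path y)); auto. }
assert (P0 : path 0 = p).
{ unfold path, clamp; rewrite Ep, Rmin_right, Rmax_left by lra; f_equal; ring. }
assert (P1 : path 1 = q).
{ unfold path, clamp; rewrite Eq, Rmin_left, Rmax_right by lra; f_equal; ring. }
assert (Nq : ~ U q).
{ intros Uq; apply (Hdisj q); split; [|auto]; rewrite <- P1; apply Dpath. }
destruct (IVT_cor chi 0 1 Cchi) as [z [_ Hz]]; [lra | |].
- unfold chi; rewrite P0, P1.
  destruct excluded_middle_informative; [|contradiction].
  destruct excluded_middle_informative; [contradiction | lra].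
- unfold chi in Hz; destruct excluded_middle_informative; lra.
Qed.

Lemma open_domain_above (a b : R) : 0 < a ->
  open_domain a (X_image a (fun s => b < s)).
Proof.
intros Ha; split.
- exists (fun p => Lambda a b < snd p); split; [apply open_above|].
  intros p; split.
  + intros [s [th [Hs [Hth ->]]]]; split; [exists s, th; auto|].
    apply Lambda_incr; assumption.
  + intros [[s [th [_ [Hth ->]]]] Hs]; exists s, th; split; [|auto].
    apply (Lambda_lt_inv a); assumption.
- apply connected_X_image; [exact Ha | intros; lra].
Qed.

Lemma open_domain_below (a b : R) : 0 < a ->
  open_domain a (X_image a (fun s => s < b)).
Proof.
intros Ha; split.
- exists (fun p => snd p < Lambda a b); split; [apply open_below|].
  intros p; split.
  + intros [s [th [Hs [Hth ->]]]]; split; [exists s, th; auto|].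
    apply Lambda_incr; assumption.
  + intros [[s [th [_ [Hth ->]]]] Hs]; exists s, th; split; [|auto].
    apply (Lambda_lt_inv a); assumption.
- apply connected_X_image; [exact Ha | intros; lra].
Qed.

(** The extra point lies over some [s <= b]; by openness, the domain reaches some
    [s0 < b]. If it missed a point of a parallel between [s0] and [b], by invariance
    it would miss the whole parallel, whose height would disconnect the domain. *)
Lemma larger_domain_contains (a b : R) (D : point -> Prop) : 0 < a ->
  open_domain a D -> rotation_invariant D ->
  strictly_larger D (X_image a (fun s => b < s)) ->
  exists b', b' < b /\ forall s th, b' <= s -> 0 <= th <= 2 * PI -> D (X a s th).
Proof.
intros Ha [[U [HU HDU]] Hconn] Hrot [Hsub [p [Dp Np]]].
assert (Hall : forall s th th', D (X a s th) -> D (X a s th')).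
{ intros s th th' H; replace th' with (th + (th' - th)) by ring.
  rewrite <- rotate_X; apply Hrot, H. }
assert (Hlow : exists s0 th0, s0 < b /\ D (X a s0 th0)).
{ destruct (proj1 (HDU p) Dp) as [[s [th [_ [Hth ->]]]] Up].
  destruct (Rtotal_order s b) as [h | [-> | h]].
  - exists s, th; auto.
  - assert (C : continuous (fun y => X a y th) b)
      by (apply continuous_X; [exact Ha | apply continuous_id | apply continuous_const]).
    destruct (C U (HU _ Up)) as [d Hd].
    exists (b - d / 2), th; assert (Hdp := cond_pos d); split; [lra|].
    apply HDU; split; [apply catenoid_X, Hth|].
    apply Hd; unfold ball; simpl; unfold AbsRing_ball, abs, minus, plus, opp.
    simpl; rewrite Rabs_left; lra.
  - destruct Np; exists s, th; auto. }
destruct Hlow as [s0 [th0 [Hs0 D0]]].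
exists s0; split; [exact Hs0|]; intros s th Hs Hth.
destruct (Rlt_le_dec b s) as [h | h]; [apply Hsub; exists s, th; auto|].
destruct Hs as [Hs | <-]; [|apply (Hall _ th0), D0].
apply Classical_Prop.NNPP; intros Hn.
apply (Hconn (fun q => snd q < Lambda a s) (fun q => Lambda a s < snd q)).
- apply open_below.
- apply open_above.
- intros q Dq; destruct (proj1 (HDU q) Dq) as [[s' [th' [_ [_ ->]]]] _].
  destruct (Rtotal_order s' s) as [h' | [-> | h']].
  + left; apply Lambda_incr; assumption.
  + destruct Hn; apply (Hall _ th'), Dq.
  + right; apply Lambda_incr; assumption.
- intros q [_ H]; lra.
- exists (X a s0 th0); split; [exact D0 | apply Lambda_incr; assumption].
- exists (X a (b + 1) 0); split.
  + apply Hsub, X_image_X; lra.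
  + apply Lambda_incr; [exact Ha | lra].
Qed.

(** It is the continuous image of a compact rectangle. *)
Lemma compact_X_image (a b c : R) : 0 < a ->
  compact_set (X_image a (fun s => b <= s <= c)).
Proof.
intros Ha J U HU Hcov.
assert (Hd : forall t : Compactness.Tn 2 R, exists d : posreal,
  bounded_n 2 (b, (0, tt)) (c, (2 * PI, tt)) t ->
  exists j, forall x, close_n 2 d x t -> U j (X a (fst x) (fst (snd x)))).
{ intros [s [th []]]; destruct (classic
    (bounded_n 2 (b, (0, tt)) (c, (2 * PI, tt)) (s, (th, tt)))) as [Hb | Hb].
  2:{ exists (mkposreal 1 Rlt_0_1); tauto. }
  simpl in Hb; destruct (Hcov (X a s th)) as [j Hj].
  { exists s, th; tauto. }
  assert (C : continuous (fun q : R * R => X a (fst q) (snd q)) (s, th)).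
  { apply continuous_X; [exact Ha | apply continuous_fst | apply continuous_snd]. }
  destruct (C (U j) (HU j _ Hj)) as [d Hd].
  exists d; intros _; exists j; intros [s' [th' []]] [H1 [H2 _]].
  apply (Hd (s', th')); split; assumption. }
apply functional_choice in Hd as [delta Hdelta].
apply Classical_Prop.NNPP; intros Hn.
apply (compactness_list 2 (b, (0, tt)) (c, (2 * PI, tt)) delta).
intros [l Hl]; apply Hn; clear Hn.
assert (Hj : exists lj : list J, forall t, In t l ->
  bounded_n 2 (b, (0, tt)) (c, (2 * PI, tt)) t ->
  exists j, In j lj /\
    forall x, close_n 2 (delta t) x t -> U j (X a (fst x) (fst (snd x)))).
{ clear Hl; induction l as [|t l [lj IH]]; [exists nil; intros t []|].
  destruct (classic (bounded_n 2 (b, (0, tt)) (c, (2 * PI, tt)) t)) as [Hb | Hb].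
  - destruct (Hdelta t Hb) as [j Hj]; exists (j :: lj); intros t' [<- | Ht'] Hb'.
    + exists j; split; [left; reflexivity | exact Hj].
    + destruct (IH t' Ht' Hb') as [j' [H1 H2]]; exists j'; split; [right|]; assumption.
  - exists lj; intros t' [<- | Ht'] Hb'; [contradiction | apply IH; assumption]. }
destruct Hj as [lj Hlj]; exists lj; intros p [s [th [Hs [Hth ->]]]].
destruct (Hl (s, (th, tt))) as [t [Ht [Hb Hc]]]; [simpl; tauto|].
destruct (Hlj t Ht Hb) as [j [Hj HU']]; exists j; split; [exact Hj|].
apply (HU' (s, (th, tt)) Hc).
Qed.

(** * Smooth functions of one variable *)

(** Continuous differentiability of order [n], in a form that is easy to
    transfer through sums, products and compositions. *)
Fixpoint smooth_n (n : nat) (f : R -> R) : Prop :=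
  match n with
  | O => forall x, continuous f x
  | S n => exists g, (forall x, is_derive f x (g x)) /\ smooth_n n g
  end.

Lemma smooth_n_continuous (n : nat) (f : R -> R) (x : R) :
  smooth_n n f -> continuous f x.
Proof.
destruct n as [|n]; [intros H; apply H|].
intros [g [Hg _]]; apply continuous_ex_derive; eexists; apply Hg.
Qed.

Lemma smooth_n_weaken (n : nat) (f : R -> R) : smooth_n (S n) f -> smooth_n n f.
Proof.
revert f; induction n as [|n IH]; intros f H.
- intros x; apply (smooth_n_continuous 1), H.
- destruct H as [g [Hg Sg]]; exists g; split; [exact Hg | apply IH, Sg].
Qed.

Lemma smooth_n_const (n : nat) (c : R) : smooth_n n (fun _ => c).
Proof.
revert c; induction n as [|n IH]; intros c.
- intros x; apply continuous_const.
- exists (fun _ => 0); split; [|apply IH].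
  intros x; apply (is_derive_const (K := R_AbsRing) (V := R_NormedModule)).
Qed.

Lemma smooth_n_plus (n : nat) (f g : R -> R) : smooth_n n f -> smooth_n n g ->
  smooth_n n (fun x => f x + g x).
Proof.
revert f g; induction n as [|n IH]; intros f g Hf Hg.
- intros x; apply (continuous_plus (V := R_NormedModule)); [apply Hf | apply Hg].
- destruct Hf as [f' [Hf Sf]]; destruct Hg as [g' [Hg Sg]].
  exists (fun x => f' x + g' x); split; [|apply IH; assumption].
  intros x; apply (is_derive_plus (V := R_NormedModule)); [apply Hf | apply Hg].
Qed.

Lemma smooth_n_mult (n : nat) (f g : R -> R) : smooth_n n f -> smooth_n n g ->
  smooth_n n (fun x => f x * g x).
Proof.
revert f g; induction n as [|n IH]; intros f g Hf Hg.
- intros x; apply (continuous_mult (K := R_AbsRing)); [apply Hf | apply Hg].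
- assert (Wf := smooth_n_weaken _ _ Hf); assert (Wg := smooth_n_weaken _ _ Hg).
  destruct Hf as [f' [Hf Sf]]; destruct Hg as [g' [Hg Sg]].
  exists (fun x => f' x * g x + f x * g' x); split.
  + intros x; apply (is_derive_mult f g x); [apply Hf | apply Hg | apply Rmult_comm].
  + apply smooth_n_plus; apply IH; assumption.
Qed.

Lemma smooth_n_comp (n : nat) (f g : R -> R) : smooth_n n f -> smooth_n n g ->
  smooth_n n (fun x => f (g x)).
Proof.
revert f g; induction n as [|n IH]; intros f g Hf Hg.
- intros x; apply (continuous_comp g f); [apply Hg | apply Hf].
- assert (Wg := smooth_n_weaken _ _ Hg).
  destruct Hf as [f' [Hf Sf]]; destruct Hg as [g' [Hg Sg]].
  exists (fun x => g' x * f' (g x)); split.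
  + intros x; apply (is_derive_comp f g x); [apply Hf | apply Hg].
  + apply smooth_n_mult; [exact Sg | apply IH; assumption].
Qed.

Lemma smooth_n_pow (n k : nat) (f : R -> R) : smooth_n n f ->
  smooth_n n (fun x => f x ^ k).
Proof.
intros Hf; induction k as [|k IH]; [apply (smooth_n_const n 1)|].
apply (smooth_n_mult n f (fun x => f x ^ k)); assumption.
Qed.

Lemma smooth_n_cosh_sinh (n : nat) : smooth_n n cosh /\ smooth_n n sinh.
Proof.
induction n as [|n [IHc IHs]].
- split; intros x; [apply continuous_cosh | apply continuous_sinh].
- split; [exists sinh | exists cosh]; split; try assumption;
    intros x; auto_derive; trivial; ring.
Qed.

(** The derivative is a smooth function times a power of the function itself,
    which allows induction on the order. *)
Lemma smooth_n_inv_sqrtW (n : nat) (a : R) : 0 < a ->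
  smooth_n n (fun s => / sqrt (W a s)).
Proof.
intros Ha; induction n as [|n IH].
- intros x; apply continuous_inv_sqrtW, Ha.
- exists (fun s => - cosh a ^ 2 * cosh s * sinh s * (/ sqrt (W a s)) ^ 3); split.
  + intros s; assert (Hw := W_gt0 a s Ha); assert (Hy := sqrtW_gt0 a s Ha).
    auto_derive; [split; [exact Hw | split; [lra | trivial]]|].
    field; lra.
  + destruct (smooth_n_cosh_sinh n) as [Hc Hs].
    apply smooth_n_mult; [|apply smooth_n_pow, IH].
    apply smooth_n_mult; [|exact Hs].
    apply smooth_n_mult; [apply smooth_n_const | exact Hc].
Qed.

Lemma smooth_n_jacobi_v (n : nat) (a : R) : 0 < a -> smooth_n n (jacobi_v a).
Proof.
intros Ha; apply (smooth_n_mult n (fun s => cosh a * sinh s)).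
- apply smooth_n_mult; [apply smooth_n_const | apply smooth_n_cosh_sinh].
- apply smooth_n_inv_sqrtW, Ha.
Qed.

Lemma smooth_n_height_var (n : nat) (a : R) : 0 < a -> smooth_n n (height_var a).
Proof.
intros Ha; apply smooth_n_weaken; exists (height_var_density a); split.
{ intros x; apply is_derive_height_var, Ha. }
replace (height_var_density a) with (fun s => cosh a * sinh s ^ 2 * (/ sqrt (W a s)) ^ 3).
- apply smooth_n_mult; [|apply smooth_n_pow, smooth_n_inv_sqrtW, Ha].
  apply smooth_n_mult; [apply smooth_n_const | apply smooth_n_pow, smooth_n_cosh_sinh].
- apply functional_extensionality; intros s; unfold height_var_density.
  assert (Hy := sqrtW_gt0 a s Ha); field; lra.
Qed.

Lemma smooth_n_jacobi_comb (n : nat) (a mu : R) : 0 < a -> smooth_n n (jacobi_comb a mu).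
Proof.
intros Ha.
replace (jacobi_comb a mu) with (fun s => mu * jacobi_v a s + (sinh a ^ 2 * cosh s *
  (/ sqrt (W a s)) ^ 2 + (-1) * (jacobi_v a s * height_var a s))).
- assert (Hv := smooth_n_jacobi_v n a Ha); assert (HB := smooth_n_height_var n a Ha).
  apply smooth_n_plus; [|apply smooth_n_plus]; apply smooth_n_mult;
    try apply smooth_n_const; try assumption.
  + apply smooth_n_mult; [apply smooth_n_const | apply smooth_n_cosh_sinh].
  + apply smooth_n_pow, smooth_n_inv_sqrtW, Ha.
  + apply smooth_n_mult; assumption.
- apply functional_extensionality; intros s; unfold jacobi_comb, jacobi_e.
  assert (Hy := sqrtW_gt0 a s Ha).
  replace ((/ sqrt (W a s)) ^ 2) with (/ W a s)
    by (rewrite <- (sqrtW_pow2 a s Ha) at 1; field; lra).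
  unfold Rdiv; ring.
Qed.

(** The functions [x ^ - k * exp (- / x)] extended by zero: their span is closed
    under differentiation. *)
Definition flat (k : nat) (x : R) : R :=
  if Rle_dec x 0 then 0 else (/ x) ^ k * exp (- / x).

Lemma flat_neg (k : nat) (x : R) : x <= 0 -> flat k x = 0.
Proof. intros H; unfold flat; destruct (Rle_dec x 0); [reflexivity | lra]. Qed.

Lemma flat_pos (k : nat) (x : R) : 0 < x -> flat k x = (/ x) ^ k * exp (- / x).
Proof. intros H; unfold flat; destruct (Rle_dec x 0); [lra | reflexivity]. Qed.

Lemma flat_gt0 (k : nat) (x : R) : 0 < x -> 0 < flat k x.
Proof.
intros H; rewrite flat_pos by exact H.
apply Rmult_lt_0_compat; [apply pow_lt, Rinv_0_lt_compat, H | apply exp_pos].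
Qed.

Lemma flat_ge0 (k : nat) (x : R) : 0 <= flat k x.
Proof.
destruct (Rle_lt_dec x 0); [rewrite flat_neg by assumption; lra|].
left; apply flat_gt0; assumption.
Qed.

Lemma flat_S (k : nat) (x : R) : x * flat (S k) x = flat k x.
Proof.
destruct (Rle_lt_dec x 0) as [h | h].
- rewrite !flat_neg by exact h; ring.
- rewrite !flat_pos by exact h; simpl; field; lra.
Qed.

Lemma pow_le_fact_exp (n : nat) (z : R) : 0 <= z ->
  z ^ S n <= INR (fact (S n)) * exp z.
Proof.
intros Hz; assert (H := exp_ge_taylor z (S n) Hz).
rewrite tech5 in H.
assert (H0 : 0 <= sum_f_R0 (fun k => z ^ k / INR (fact k)) n).
{ apply cond_pos_sum; intros k; apply Rmult_le_pos; [apply pow_le, Hz|].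
  left; apply Rinv_0_lt_compat, INR_fact_lt_0. }
assert (Hf := INR_fact_lt_0 (S n)).
rewrite Rmult_comm; apply (Rle_div_l (z ^ S n) _ (INR (fact (S n)))); lra.
Qed.

(** This gives differentiability at [0]; it comes from one term of the
    exponential series at [/ x]. *)
Lemma flat_le_square (k : nat) (x : R) :
  flat k x <= INR (fact (S (S k))) * x ^ 2.
Proof.
destruct (Rle_lt_dec x 0) as [h | h].
- rewrite flat_neg by exact h; apply Rmult_le_pos; [apply pos_INR | apply pow2_ge_0].
- rewrite flat_pos by exact h; assert (Hi := Rinv_0_lt_compat x h).
  assert (H := pow_le_fact_exp (S k) (/ x) (Rlt_le _ _ Hi)).
  rewrite exp_Ropp; assert (He := exp_pos (/ x)).
  apply (Rle_div_l _ _ (exp (/ x))); [exact He|].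
  replace ((/ x) ^ k) with ((/ x) ^ S (S k) * x ^ 2) by (simpl; field; lra).
  assert (0 <= x ^ 2) by apply pow2_ge_0.
  apply Rle_trans with (INR (fact (S (S k))) * exp (/ x) * x ^ 2); [|lra].
  apply Rmult_le_compat_r; assumption.
Qed.

(** Differentiating [x ^ - k * exp (- / x)] gives the formula for [x > 0]. *)
Lemma is_derive_flat (k : nat) (x : R) :
  is_derive (flat k) x (- INR k * flat (S k) x + flat (S (S k)) x).
Proof.
destruct (Rtotal_order x 0) as [h | [-> | h]].
- rewrite !flat_neg by lra.
  apply (is_derive_ext_loc (fun _ => 0)).
  + apply (filter_imp (fun y => y < 0)); [|apply (open_lt 0), h].
    intros y Hy; symmetry; apply flat_neg; lra.
  + replace (- INR k * 0 + 0) with 0 by ring.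
    apply (is_derive_const (K := R_AbsRing) (V := R_NormedModule)).
- rewrite !flat_neg by lra; replace (- INR k * 0 + 0) with 0 by ring.
  apply is_derive_Reals; intros eps Heps.
  pose (M := INR (fact (S (S k)))); assert (HM : 0 < M) by apply INR_fact_lt_0.
  assert (Hd : 0 < eps / M) by (apply Rdiv_lt_0_compat; assumption).
  exists (mkposreal _ Hd); intros z Hz Hzd; simpl in Hzd.
  rewrite Rplus_0_l, (flat_neg k 0), !Rminus_0_r by lra.
  unfold Rdiv; rewrite Rabs_mult, Rabs_inv.
  assert (Ha : 0 < Rabs z) by apply Rabs_pos_lt, Hz.
  apply (Rlt_div_l _ _ (Rabs z)); [exact Ha|].
  rewrite Rabs_right by (apply Rle_ge, flat_ge0).
  apply Rle_lt_trans with (1 := flat_le_square k z); fold M.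
  rewrite <- pow2_abs.
  apply (Rlt_div_r (Rabs z) eps M) in Hzd; [|exact HM].
  replace (M * Rabs z ^ 2) with (Rabs z * M * Rabs z) by ring.
  apply Rmult_lt_compat_r; assumption.
- rewrite !flat_pos by exact h.
  apply (is_derive_ext_loc (fun y => (/ y) ^ k * exp (- / y))).
  + apply (filter_imp (fun y => 0 < y)); [|apply (open_gt 0), h].
    intros y Hy; symmetry; apply flat_pos, Hy.
  + auto_derive; [repeat split; lra|].
    destruct k as [|k]; [simpl; field; lra|].
    change (Init.Nat.pred (S k)) with k; simpl pow.
    field; lra.
Qed.

Lemma smooth_n_flat (n k : nat) : smooth_n n (flat k).
Proof.
revert k; induction n as [|n IH]; intros k.
- intros x; apply continuous_ex_derive; eexists; apply is_derive_flat.
- exists (fun x => - INR k * flat (S k) x + flat (S (S k)) x); split.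
  + intros x; apply is_derive_flat.
  + apply smooth_n_plus; [|apply IH].
    apply smooth_n_mult; [apply smooth_n_const | apply IH].
Qed.

Lemma ex_diff_n_smooth (n : nat) (g : R -> R) (s t : R) :
  smooth_n n g -> ex_diff_n (fun x _ => g x) n s t.
Proof.
revert g; induction n as [|n IH]; intros g Hg.
- split; [|exact I]; apply continuity_2d_of_continuous, Hg.
- split; [apply continuity_2d_of_continuous, (smooth_n_continuous (S n)), Hg|].
  destruct Hg as [g' [Hg Sg]].
  split; [eexists; apply Hg|].
  split; [apply (ex_derive_const (K := R_AbsRing) (V := R_NormedModule))|].
  split.
  + replace (fun u v : R => Derive (fun z => g z) u) with (fun u (_ : R) => g' u);
      [apply IH, Sg|].
    apply functional_extensionality; intros u; apply functional_extensionality; intros _.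
    symmetry; apply is_derive_unique, Hg.
  + replace (fun u v : R => Derive (fun z : R => g u) v)
      with (fun (_ _ : R) => 0); [apply (IH (fun _ => 0)), smooth_n_const|].
    apply functional_extensionality; intros u; apply functional_extensionality; intros v.
    symmetry; apply Derive_const.
Qed.

(** * Instability *)

Lemma RInt_gt_0_of_point (h : R -> R) (b c x : R) : b < x < c ->
  (forall y, continuous h y) -> (forall y, 0 <= h y) -> 0 < h x ->
  0 < RInt h b c.
Proof.
intros Hx Hc H0 Hp.
assert (L : locally x (fun y => 0 < h y)) by (apply (Hc x), open_gt, Hp).
destruct L as [d Hd]; assert (Hdp := cond_pos d).
pose (r := Rmin (d / 2) (Rmin (x - b) (c - x))).
assert (Hr : 0 < r) by (unfold r; repeat apply Rmin_glb_lt; lra).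
assert (H1 : r <= d / 2) by apply Rmin_l.
assert (H2 : r <= Rmin (x - b) (c - x)) by apply Rmin_r.
assert (H3 := Rmin_l (x - b) (c - x)); assert (H4 := Rmin_r (x - b) (c - x)).
assert (Hex : forall u v, ex_RInt h u v).
{ intros u v; apply (ex_RInt_continuous (V := R_CompleteNormedModule)); auto. }
rewrite <- (RInt_Chasles (V := R_CompleteNormedModule) h b (x - r) c) by apply Hex.
rewrite <- (RInt_Chasles (V := R_CompleteNormedModule) h (x - r) (x + r) c) by apply Hex.
assert (P1 : 0 <= RInt h b (x - r)) by (apply RInt_ge_0; auto; lra).
assert (P2 : 0 <= RInt h (x + r) c) by (apply RInt_ge_0; auto; lra).
assert (P3 : 0 < RInt h (x - r) (x + r)).
{ apply RInt_gt_0; [lra | | auto].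
  intros y Hy; apply Hd; unfold ball; simpl; unfold AbsRing_ball, abs, minus, plus, opp.
  simpl; apply Rabs_def1; lra. }
unfold plus; simpl; lra.
Qed.

(** This is [phi (1 + K w)] with [phi x = x * exp (- / x)] for positive [x]. The
    constant [1] has [J 1 = - q < 0] and [J w = 0], so [U = 1 + K w] satisfies
    [J U < 0]; the convex function [phi] replaces the positive part of [U] by a
    smooth function. *)
Definition test_fun (a K mu s : R) : R :=
  (1 + K * jacobi_comb a mu s) * flat 0 (1 + K * jacobi_comb a mu s).

Definition dtest_fun (a K mu s : R) : R :=
  (flat 0 (1 + K * jacobi_comb a mu s) + flat 1 (1 + K * jacobi_comb a mu s)) *
  (K * djacobi_comb a mu s).

(** Here [phi' = flat 0 + flat 1]. *)
Lemma is_derive_test_fun (a K mu s : R) : 0 < a ->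
  is_derive (test_fun a K mu) s (dtest_fun a K mu s).
Proof.
intros Ha; unfold test_fun, dtest_fun.
assert (Hw : is_derive (fun s => 1 + K * jacobi_comb a mu s) s (K * djacobi_comb a mu s)).
{ assert (H := is_derive_jacobi_comb a mu s Ha).
  auto_derive; [eexists; exact H|].
  replace (Derive (fun x => jacobi_comb a mu x) s) with (djacobi_comb a mu s)
    by (symmetry; apply is_derive_unique, H); ring. }
set (U := fun s => 1 + K * jacobi_comb a mu s) in *.
change (is_derive (fun s => U s * flat 0 (U s)) s
  ((flat 0 (U s) + flat 1 (U s)) * (K * djacobi_comb a mu s))).
assert (H0 := is_derive_flat 0 (U s)).
auto_derive.
- repeat split; eexists; eassumption.
- replace (Derive (fun x => U x) s) with (K * djacobi_comb a mu s)
    by (symmetry; apply is_derive_unique, Hw).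
  replace (Derive (fun x => flat 0 x) (U s))
    with (- INR 0 * flat 1 (U s) + flat 2 (U s))
    by (symmetry; apply is_derive_unique, H0).
  rewrite <- (flat_S 1 (U s)); simpl; ring.
Qed.

(** Here [phi'' = flat 3], and [sqrt W] times the derivative of [w] has
    derivative [- sqrt W q w]. *)
Lemma is_derive_flux_test_fun (a K mu s : R) : 0 < a ->
  is_derive (fun y => sqrt (W a y) * dtest_fun a K mu y) s
    (flat 3 (1 + K * jacobi_comb a mu s) * sqrt (W a s) * (K * djacobi_comb a mu s) ^ 2 -
     (flat 0 (1 + K * jacobi_comb a mu s) + flat 1 (1 + K * jacobi_comb a mu s)) *
     (sqrt (W a s) * potential a s * (K * jacobi_comb a mu s))).
Proof.
intros Ha.
assert (Hw : is_derive (fun s => 1 + K * jacobi_comb a mu s) s (K * djacobi_comb a mu s)).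
{ assert (H := is_derive_jacobi_comb a mu s Ha).
  auto_derive; [eexists; exact H|].
  replace (Derive (fun x => jacobi_comb a mu x) s) with (djacobi_comb a mu s)
    by (symmetry; apply is_derive_unique, H); ring. }
assert (HF := is_derive_flux_jacobi_comb a mu s Ha).
set (F := fun u => sqrt (W a u) * djacobi_comb a mu u) in *.
assert (H0 := is_derive_flat 0 (1 + K * jacobi_comb a mu s)).
assert (H1 := is_derive_flat 1 (1 + K * jacobi_comb a mu s)).
apply (is_derive_ext (fun y => (flat 0 (1 + K * jacobi_comb a mu y) +
  flat 1 (1 + K * jacobi_comb a mu y)) * (K * F y))).
{ intros y; unfold dtest_fun, F; simpl; ring. }
pose (U := fun s => 1 + K * jacobi_comb a mu s); fold U in Hw.
change (1 + K * jacobi_comb a mu s) with (U s) in *.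
apply (is_derive_ext (fun y => (flat 0 (U y) + flat 1 (U y)) * (K * F y)));
  [reflexivity|].
auto_derive.
- repeat split; eexists; eassumption.
- replace (Derive (fun x => U x) s) with (K * djacobi_comb a mu s)
    by (symmetry; apply is_derive_unique, Hw).
  replace (Derive (fun x => F x) s)
    with (- sqrt (W a s) * potential a s * jacobi_comb a mu s)
    by (symmetry; apply is_derive_unique, HF).
  replace (Derive (fun x => flat 0 x) (U s))
    with (- INR 0 * flat 1 (U s) + flat 2 (U s))
    by (symmetry; apply is_derive_unique, H0).
  replace (Derive (fun x => flat 1 x) (U s))
    with (- INR 1 * flat 2 (U s) + flat 3 (U s))
    by (symmetry; apply is_derive_unique, H1).
  unfold F; simpl; ring.
Qed.

Lemma smooth_n_test_fun (n : nat) (a K mu : R) : 0 < a -> smooth_n n (test_fun a K mu).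
Proof.
intros Ha.
assert (HU : smooth_n n (fun s => 1 + K * jacobi_comb a mu s)).
{ apply smooth_n_plus; [apply smooth_n_const|].
  apply smooth_n_mult; [apply smooth_n_const | apply smooth_n_jacobi_comb, Ha]. }
apply smooth_n_mult; [exact HU|].
apply (smooth_n_comp n (flat 0)); [apply smooth_n_flat | exact HU].
Qed.

(** Minus the integrand of the stability form at [phi (U)]. The second term comes
    from [phi' (U) * (U - 1) - phi (U) = - flat 1 U]. *)
Definition test_fun_density (a K mu s : R) : R :=
  let U := 1 + K * jacobi_comb a mu s in
  U * flat 0 U * sqrt (W a s) *
  (flat 3 U * (K * djacobi_comb a mu s) ^ 2 + potential a s * flat 1 U).

Lemma energy_test_fun (a K mu s t : R) : 0 < a ->
  test_fun a K mu s * jacobi_op (X a) (fun s _ => test_fun a K mu s) s t *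
  sqrt (hdet (X a) s t) = - test_fun_density a K mu s.
Proof.
intros Ha; rewrite hdetE, Rmult_assoc, jacobi_opE by exact Ha.
replace (Derive (fun s' => sqrt (W a s') * Derive (fun z => test_fun a K mu z) s') s)
  with (flat 3 (1 + K * jacobi_comb a mu s) * sqrt (W a s) * (K * djacobi_comb a mu s) ^ 2 -
     (flat 0 (1 + K * jacobi_comb a mu s) + flat 1 (1 + K * jacobi_comb a mu s)) *
     (sqrt (W a s) * potential a s * (K * jacobi_comb a mu s))).
2:{ symmetry; apply is_derive_unique.
    apply (is_derive_ext (fun y => sqrt (W a y) * dtest_fun a K mu y));
      [|apply is_derive_flux_test_fun, Ha].
    intros y; f_equal; symmetry; apply is_derive_unique, is_derive_test_fun, Ha. }
replace (Derive (fun t => Derive (fun _ => test_fun a K mu s) t) t) with 0.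
2:{ symmetry; rewrite (Derive_ext _ (fun _ => 0));
      [apply Derive_const | intros y; apply Derive_const]. }
unfold test_fun, test_fun_density; cbv zeta.
assert (E := flat_S 0 (1 + K * jacobi_comb a mu s)).
replace (K * jacobi_comb a mu s) with ((1 + K * jacobi_comb a mu s) - 1) by ring.
replace (1 + (1 + K * jacobi_comb a mu s - 1)) with (1 + K * jacobi_comb a mu s) by ring.
set (U := 1 + K * jacobi_comb a mu s) in *.
unfold Rdiv; rewrite <- E; ring.
Qed.

Lemma potential_gt0 (a s : R) : 0 < a -> 0 < potential a s.
Proof.
intros Ha; unfold potential; apply Rdiv_lt_0_compat; [|apply pow_lt, W_gt0, Ha].
apply Rmult_lt_0_compat; [apply pow_lt, sinh_gt0, Ha|].
assert (H := W_gt0 a s Ha); unfold W in H; lra.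
Qed.

Lemma test_fun_density_ge0 (a K mu s : R) : 0 < a -> 0 <= test_fun_density a K mu s.
Proof.
intros Ha; unfold test_fun_density; cbv zeta.
set (U := 1 + K * jacobi_comb a mu s).
destruct (Rle_lt_dec U 0) as [h | h]; [rewrite flat_neg by exact h; lra|].
assert (H0 := flat_ge0 0 U); assert (H1 := flat_ge0 1 U); assert (H3 := flat_ge0 3 U).
assert (Hy := sqrtW_gt0 a s Ha); assert (Hq := potential_gt0 a s Ha).
assert (Hs := pow2_ge_0 (K * djacobi_comb a mu s)).
repeat first [lra | apply Rmult_le_pos | apply Rplus_le_le_0_compat].
Qed.

Lemma test_fun_density_gt0 (a K mu s : R) : 0 < a ->
  0 < 1 + K * jacobi_comb a mu s -> 0 < test_fun_density a K mu s.
Proof.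
intros Ha h; unfold test_fun_density; cbv zeta.
set (U := 1 + K * jacobi_comb a mu s) in *.
assert (H0 := flat_gt0 0 U h); assert (H1 := flat_gt0 1 U h); assert (H3 := flat_ge0 3 U).
assert (Hy := sqrtW_gt0 a s Ha); assert (Hq := potential_gt0 a s Ha).
assert (Hs := pow2_ge_0 (K * djacobi_comb a mu s)).
apply Rmult_lt_0_compat; [repeat apply Rmult_lt_0_compat; assumption|].
apply Rplus_le_lt_0_compat; [apply Rmult_le_pos | apply Rmult_lt_0_compat]; assumption.
Qed.

Lemma continuous_test_fun_density (a K mu s : R) : 0 < a ->
  continuous (test_fun_density a K mu) s.
Proof.
intros Ha; unfold test_fun_density; cbv zeta.
assert (Cw := continuous_jacobi_comb a mu s Ha).
assert (CU : continuous (fun s => 1 + K * jacobi_comb a mu s) s).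
{ apply (continuous_plus (V := R_NormedModule)); [apply continuous_const|].
  apply (continuous_mult (K := R_AbsRing)); [apply continuous_const | exact Cw]. }
assert (CP : forall k, continuous (fun s => flat k (1 + K * jacobi_comb a mu s)) s).
{ intros k; apply (continuous_comp (fun s => 1 + K * jacobi_comb a mu s) (flat k));
    [exact CU | apply (smooth_n_flat 0)]. }
assert (CY := continuous_sqrtW a s Ha).
assert (CQ := continuous_potential a s Ha).
assert (CD : continuous (djacobi_comb a mu) s).
{ apply (continuous_ext (fun s => / sqrt (W a s) * (sqrt (W a s) * djacobi_comb a mu s))).
  - intros y; assert (Hy := sqrtW_gt0 a y Ha).
    rewrite <- Rmult_assoc, Rinv_l, Rmult_1_l by lra; reflexivity.
  - apply (continuous_mult (K := R_AbsRing)); [apply continuous_inv_sqrtW, Ha|].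
    apply continuous_ex_derive; eexists; apply is_derive_flux_jacobi_comb, Ha. }
assert (CKD : continuous (fun s => (K * djacobi_comb a mu s) ^ 2) s).
{ apply (continuous_comp (fun s => K * djacobi_comb a mu s) (fun y => y ^ 2)).
  - apply (continuous_mult (K := R_AbsRing)); [apply continuous_const | exact CD].
  - apply continuous_ex_derive; auto_derive; trivial. }
apply (continuous_mult (K := R_AbsRing)).
- apply (continuous_mult (K := R_AbsRing)); [|exact CY].
  apply (continuous_mult (K := R_AbsRing)); [exact CU | apply CP].
- apply (continuous_plus (V := R_NormedModule)).
  + apply (continuous_mult (K := R_AbsRing)); [apply CP | exact CKD].
  + apply (continuous_mult (K := R_AbsRing)); [exact CQ | apply CP].
Qed.

(** As the height determines [s], every function of [s] comes from a function on
    the ambient space. *)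
Definition of_height (a : R) (g : R -> R) (p : point) : R :=
  g (iota (T := R_CompleteNormedModule) (fun s => Lambda a s = snd p)).

Lemma pullback_of_height (a : R) (g : R -> R) : 0 < a ->
  pullback a (of_height a g) = fun s _ => g s.
Proof.
intros Ha; apply functional_extensionality; intros s.
apply functional_extensionality; intros th.
unfold pullback, of_height; f_equal.
apply (iota_unique (V := R_CompleteNormedModule)); rewrite snd_X; [|reflexivity].
intros y Hy; apply (Lambda_inj a); assumption.
Qed.

(** The test function vanishes outside a compact interval [[b, c]], and its
    stability form is [- 2 * PI] times the integral of a nonnegative continuous
    function, positive at [0]. *)
Lemma not_weakly_stable_of_containing (a E mu l b : R) (D : point -> Prop) :
  0 < a -> is_sup_height_var a E -> mu < E -> 0 < l < - b -> jacobi_ratio a l = mu ->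
  (forall s th, b <= s -> 0 <= th <= 2 * PI -> D (X a s th)) ->
  ~ weakly_stable a D.
Proof.
intros Ha HE Hmu Hl Hq HD Hst.
destruct (jacobi_comb_lt a E mu l b Ha HE Hmu Hl Hq) as [c [d [Hbc [Hd Hw]]]].
(* As [w <= - d] outside [[b, c]], the factor [/ d] is large enough. *)
assert (HU : forall s, s <= b \/ c <= s -> 1 + / d * jacobi_comb a mu s <= 0).
{ intros s Hs; apply Hw in Hs.
  assert (Hi := Rinv_0_lt_compat d Hd).
  assert (/ d * jacobi_comb a mu s <= / d * - d) by (apply Rmult_le_compat_l; lra).
  replace (/ d * - d) with (-1) in H by (field; lra); lra. }
assert (Hp0 : 0 < 1 + / d * jacobi_comb a mu 0).
{ rewrite jacobi_comb_0 by exact Ha; assert (Hi := Rinv_0_lt_compat d Hd); lra. }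
assert (Hbc0 : b < 0 < c).
{ split; [lra|]; apply Rnot_le_lt; intros h.
  assert (H := HU 0 (or_intror h)); lra. }
pose (g := test_fun a (/ d) mu).
assert (H2PI : 0 < 2 * PI) by (assert (H := PI_RGT_0); lra).
assert (Hint : 0 <= surface_integral (X a) (fun s th =>
  pullback a (of_height a g) s th *
  jacobi_op (X a) (pullback a (of_height a g)) s th)).
{ apply Hst.
  - intros n s th; rewrite pullback_of_height by exact Ha.
    apply ex_diff_n_smooth, smooth_n_test_fun, Ha.
  - exists (X_image a (fun s => b <= s <= c)); split; [|split].
    + apply compact_X_image, Ha.
    + intros p [s [th [Hs [Hth ->]]]]; apply HD; [apply Hs | exact Hth].
    + intros p [s [th [_ [Hth ->]]]] Hn.
      assert (Ep : of_height a g (X a s th) = g s)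
        by apply (f_equal (fun F => F s th) (pullback_of_height a g Ha)).
      rewrite Ep; unfold g, test_fun; rewrite flat_neg; [ring|].
      apply HU; apply Classical_Prop.NNPP; intros H; apply Hn.
      exists s, th; split; [lra | auto]. }
rewrite pullback_of_height in Hint by exact Ha; unfold surface_integral in Hint.
assert (Hen : forall s, RInt (fun th => g s *
    jacobi_op (X a) (fun s _ => g s) s th * sqrt (hdet (X a) s th)) 0 (2 * PI) =
  2 * PI * - test_fun_density a (/ d) mu s).
{ intros s; rewrite (RInt_ext _ (fun _ => - test_fun_density a (/ d) mu s)).
  - rewrite (RInt_const (V := R_CompleteNormedModule)); unfold scal; simpl.
    unfold mult; simpl; rewrite Rminus_0_r; reflexivity.
  - intros t _; apply energy_test_fun, Ha. }
rewrite (RInt_gen_compact _ b c) in Hint.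
- rewrite (RInt_ext _ (fun s => scal (- (2 * PI)) (test_fun_density a (/ d) mu s))) in Hint.
  + rewrite (RInt_scal (V := R_CompleteNormedModule)) in Hint.
    * assert (Hpos : 0 < RInt (test_fun_density a (/ d) mu) b c).
      { apply (RInt_gt_0_of_point _ b c 0); [exact Hbc0 | | |].
        - intros y; apply continuous_test_fun_density, Ha.
        - intros y; apply test_fun_density_ge0, Ha.
        - apply test_fun_density_gt0; assumption. }
      unfold scal in Hint; simpl in Hint; unfold mult in Hint; simpl in Hint.
      assert (0 < 2 * PI * RInt (test_fun_density a (/ d) mu) b c)
        by (apply Rmult_lt_0_compat; assumption).
      lra.
    * apply (ex_RInt_continuous (V := R_CompleteNormedModule)); intros y _.
      apply continuous_test_fun_density, Ha.
  + intros s _; rewrite Hen; unfold scal; simpl; unfold mult; simpl; ring.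
- lra.
- apply (ex_RInt_continuous (V := R_CompleteNormedModule)); intros y _.
  apply (continuous_ext (fun s => scal (- (2 * PI)) (test_fun_density a (/ d) mu s))).
  + intros s; rewrite Hen; unfold scal; simpl; unfold mult; simpl; ring.
  + apply (continuous_scal_r (V := R_NormedModule)), continuous_test_fun_density, Ha.
- intros s Hs; rewrite Hen; unfold test_fun_density; cbv zeta.
  rewrite !flat_neg by (apply HU, Hs); ring.
Qed.

(** * The critical domain *)

Lemma open_interval_above (b : R) : is_open_interval (fun s => b < s).
Proof.
split; [exists (b + 1); lra|]; split; [|intros ? ? ?; cbv beta; lra].
intros s Hs; exists ((b + s) / 2), (s + 1); lra.
Qed.

Lemma open_interval_below (b : R) : is_open_interval (fun s => s < b).
Proof.
split; [exists (b - 1); lra|]; split; [|intros ? ? ?; cbv beta; lra].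
intros s Hs; exists (s - 1), ((b + s) / 2); lra.
Qed.

Lemma weakly_stable_D_prime (a E l : R) : 0 < a -> is_sup_height_var a E ->
  0 < l -> jacobi_ratio a l = E -> weakly_stable a (D_prime a l).
Proof.
intros Ha HE Hl Hq.
apply (weakly_stable_of_positive_solution a _ (jacobi_comb a E) (djacobi_comb a E) Ha).
- apply open_interval_above.
- intros s _; apply is_derive_jacobi_comb, Ha.
- intros s _; apply is_derive_flux_jacobi_comb, Ha.
- intros s Hs; apply (jacobi_comb_gt0 a E l s); assumption.
Qed.

Lemma is_derive_reflect (f : R -> R) (x d : R) : is_derive f (- x) d ->
  is_derive (fun y => f (- y)) x (- d).
Proof.
intros H; replace (- d) with (scal (-1) d)
  by (unfold scal; simpl; unfold mult; simpl; ring).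
apply (is_derive_comp f (fun y => - y)); [exact H|].
auto_derive; [trivial | ring].
Qed.

(** The coefficients of the Jacobi equation being even, [s |-> w (- s)] is again a
    solution. *)
Lemma weakly_stable_reflected (a E l : R) : 0 < a -> is_sup_height_var a E ->
  0 < l -> jacobi_ratio a l = E -> weakly_stable a (X_image a (fun s => s < l)).
Proof.
intros Ha HE Hl Hq.
apply (weakly_stable_of_positive_solution a _ (fun s => jacobi_comb a E (- s))
  (fun s => - djacobi_comb a E (- s)) Ha).
- apply open_interval_below.
- intros s _; apply is_derive_reflect, is_derive_jacobi_comb, Ha.
- intros s _; apply (is_derive_ext (fun y => - (sqrt (W a (- y)) * djacobi_comb a E (- y)))).
  { intros y; rewrite W_opp; apply Ropp_mult_distr_r. }
  replace (- sqrt (W a s) * potential a s * jacobi_comb a E (- s))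
    with (- - (- sqrt (W a (- s)) * potential a (- s) * jacobi_comb a E (- s))).
  2:{ unfold potential; rewrite W_opp, cosh_opp; ring. }
  apply (is_derive_opp (V := R_NormedModule)),
    (is_derive_reflect (fun u => sqrt (W a u) * djacobi_comb a E u)).
  apply is_derive_flux_jacobi_comb, Ha.
- intros s Hs; apply (jacobi_comb_gt0 a E l); try assumption; lra.
Qed.

(** A larger domain contains the parallel at some [b < - l]; the solution
    vanishing at [- l'], with [l'] halfway between [l] and [- b], shows that it
    is not weakly stable. *)
Lemma maximally_weakly_stable_D_prime (a E l : R) : 0 < a -> is_sup_height_var a E ->
  0 < l -> jacobi_ratio a l = E -> maximally_weakly_stable_rot a (D_prime a l).
Proof.
intros Ha HE Hl Hq; split; [apply (weakly_stable_D_prime a E); assumption|].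
intros D HD Hrot Hlarger.
destruct (larger_domain_contains a (- l) D Ha HD Hrot Hlarger) as [b [Hb HDb]].
pose (l' := (l - b) / 2).
assert (Hl' : l < l' < - b) by (unfold l'; lra).
apply (not_weakly_stable_of_containing a E (jacobi_ratio a l') l' b D); try assumption;
  try reflexivity; try lra.
rewrite <- Hq; apply jacobi_ratio_decr; lra.
Qed.

Lemma strictly_larger_X_image (a s : R) (I I' : R -> Prop) : 0 < a ->
  (forall x, I x -> I' x) -> I' s -> ~ I s ->
  strictly_larger (X_image a I') (X_image a I).
Proof.
intros Ha Hsub H' H; split.
- intros p [x [th [Hx [Hth ->]]]]; exists x, th; auto.
- exists (X a s 0); split; [apply X_image_X, H'|].
  intros HX; apply H, (X_image_inv a I s 0 Ha), HX.
Qed.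

Theorem theorem5p2 (a : R) (ha : 0 < a) :
  ~ Lindelof_property a /\
  ~ maximally_weakly_stable a (D_plus a) /\
  ~ maximally_weakly_stable a (D_minus a) /\
  exists z : R,
    unique (fun s => 0 < s /\ e a s = 0) z /\
    exists! l : R,
      (0 < l < z) /\ maximally_weakly_stable_rot a (D_prime a l).
Proof.
destruct (is_sup_height_var_ex a ha) as [E HE]; assert (HE0 := sup_height_var_gt0 a E ha HE).
destruct (jacobi_ratio_surj a E E ha HE) as [l [Hl Hq]]; [lra|].
destruct (jacobi_ratio_surj a E 0 ha HE) as [z [Hz Hqz]]; [lra|].
assert (Hdp : strictly_larger (D_prime a l) (D_plus a)).
{ apply (strictly_larger_X_image a 0); [exact ha | | |]; cbv beta; intros; lra. }
assert (Hst : weakly_stable a (D_prime a l))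
  by (apply (weakly_stable_D_prime a E); assumption).
split; [|split; [|split]].
- intros [_ Hmax]; apply (Hmax (D_prime a l)); try assumption.
  + apply open_domain_above, ha.
  + apply rotation_invariant_X_image.
- intros [_ Hmax]; apply (Hmax (D_prime a l)); try assumption.
  apply open_domain_above, ha.
- intros [_ Hmax]; apply (Hmax (X_image a (fun s => s < l))).
  + apply open_domain_below, ha.
  + apply (strictly_larger_X_image a 0); [exact ha | | |]; cbv beta; intros; lra.
  + apply (weakly_stable_reflected a E); assumption.
- exists z; split.
  + split.
    * split; [exact Hz|]; rewrite e_jacobi_e, jacobi_e_factor, Hqz by lra; ring.
    * intros s [Hs H0]; rewrite e_jacobi_e, jacobi_e_factor in H0 by lra.
      assert (Hv := jacobi_v_gt0 a s ha Hs).
      assert (Hqs : jacobi_ratio a s = 0)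
        by (apply Rmult_integral in H0; destruct H0; [lra | assumption]).
      destruct (Rtotal_order z s) as [h | [h | h]]; [|exact h|].
      -- assert (H := jacobi_ratio_decr a z s ha (conj Hz h)); lra.
      -- assert (H := jacobi_ratio_decr a s z ha (conj Hs h)); lra.
  + exists l; split.
    * split; [|apply (maximally_weakly_stable_D_prime a E); assumption].
      split; [exact Hl|].
      destruct (Rtotal_order l z) as [h | [-> | h]]; [exact h | lra |].
      assert (H := jacobi_ratio_decr a z l ha (conj Hz h)); lra.
    * intros l' [Hl' [Hst' Hmax']].
      assert (Hcmp : forall l1 l2, l1 < l2 -> weakly_stable a (D_prime a l2) ->
        ~ maximally_weakly_stable_rot a (D_prime a l1)).
      { intros l1 l2 h Hst2 [_ Hmax1]; apply (Hmax1 (D_prime a l2)); try assumption.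
        - apply open_domain_above, ha.
        - apply rotation_invariant_X_image.
        - apply (strictly_larger_X_image a (- l1)); [exact ha | | |]; cbv beta; intros; lra. }
      destruct (Rtotal_order l l') as [h | [h | h]]; [|exact h|].
      -- destruct (Hcmp l l' h Hst').
         apply (maximally_weakly_stable_D_prime a E); assumption.
      -- destruct (Hcmp l' l h Hst); split; assumption.
Qed.
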